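(* Let $G \subset \mathbb{R}^n$ be a convex body (a compact convex set with non-empty interior), and let $\mathcal{K}(G)$ denote the set of all compact convex subsets of $G$. For $K,L \in \mathcal{K}(G)$ define $$d_G(K,L) := \sum_{j=0}^{n}\Big( 2\,\mathrm{MV}_j(G, K\,\widetilde{\cup}\, L) - \mathrm{MV}_j(G,K) - \mathrm{MV}_j(G,L)\Big).$$ Then there exists a constant $C>1$, depending only on $G$, such that $$\frac{1}{C}\, d_{\mathcal{H}}(K,L)^n \le d_G(K,L) \le C\, d_{\mathcal{H}}(K,L) \qquad \text{for all } K,L\in\mathcal{K}(G).$$
   Context: $K\,\widetilde{\cup}\,L$ denotes the closed convex hull of $K\cup L$. $d_{\mathcal H}$ is the Hausdorff distance: $d_{\mathcal H}(K,L)=\inf\{\delta>0: K\subset L+\delta B,\ L\subset K+\delta B\}$, where $B$ is the closed unit ball centered at the origin. The mixed volume $\mathrm{MV}(K_1,\dots,K_n)$ of compact convex sets $K_1,\dots,K_n\subset\mathbb{R}^n$ is the unique symmetric function such that $\mathrm{Vol}(t_1K_1+\cdots+t_nK_n)=\sum_{i_1,\dots,i_n=1}^n t_{i_1}\cdots t_{i_n}\mathrm{MV}(K_{i_1},\dots,K_{i_n})$ for all $t_1,\dots,t_n\ge 0$ (Minkowski sums, Lebesgue volume). $\mathrm{MV}_j(G,K):=\mathrm{MV}(G,\dots,G,K,\dots,K)$ with $G$ appearing $n-j$ times and $K$ appearing $j$ times. *)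

(* Defs.v *)
(* Points of R^n are row vectors 'rV[R]_n
   (with the product topology = Euclidean topology). *)
From HB Require Import structures.
From mathcomp Require Import all_boot all_order all_algebra all_fingroup.
From mathcomp Require Import all_classical all_reals all_analysis.
Import Order.TTheory GRing.Theory Num.Theory.
Import numFieldNormedType.Exports.
Set Implicit Arguments. Unset Strict Implicit. Unset Printing Implicit Defensive.
Local Open Scope classical_set_scope.
Local Open Scope ring_scope.

Section Defs.
Context {R : realType} {n : nat}.
Implicit Types (A B K L : set 'rV[R]_n) (x y : 'rV[R]_n).

Definition enorm x : R := Num.sqrt (\sum_(i < n) x ord0 i ^+ 2).

Definition convex_set A : Prop :=
  forall x y t, A x -> A y -> 0 <= t <= 1 -> A (t *: x + (1 - t) *: y).

Definition convex_body A : Prop := compact A /\ convex_set A /\ (A°) !=set0.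

Definition cchull_union K L : set 'rV[R]_n :=
  [set x | forall C, closed C -> convex_set C -> K `|` L `<=` C -> C x].

Definition mink_comb (t : 'I_n -> R) (Ks : 'I_n -> set 'rV[R]_n) :
  set 'rV[R]_n :=
  [set x | exists a : 'I_n -> 'rV[R]_n,
           (forall i, Ks i (a i)) /\ x = \sum_(i < n) t i *: a i].

Definition enlarge A (delta : R) : set 'rV[R]_n :=
  [set x | exists2 y, A y & enorm (x - y) <= delta].

Definition hausdorff_dist K L : R :=
  inf [set delta : R | 0 < delta /\ K `<=` enlarge L delta /\ L `<=` enlarge K delta].

Definition box (a b : 'rV[R]_n) : set 'rV[R]_n :=
  [set x | forall i, a ord0 i <= x ord0 i <= b ord0 i].
Definition box_vol (a b : 'rV[R]_n) : R := \prod_(i < n) (b ord0 i - a ord0 i).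

Definition volume A : \bar R :=
  ereal_inf [set s : \bar R | exists (a b : nat -> 'rV[R]_n),
    [/\ (forall k i, a k ord0 i <= b k ord0 i),
        A `<=` \bigcup_k box (a k) (b k) &
        s = (\sum_(0 <= k <oo) (box_vol (a k) (b k))%:E)%E]].

Definition cc_set A : Prop := compact A /\ convex_set A /\ A !=set0.

Definition is_mixed_volume (MV : ('I_n -> set 'rV[R]_n) -> R) : Prop :=
  (forall (Ks : 'I_n -> set 'rV[R]_n) (s : 'S_n),
      (forall i, cc_set (Ks i)) -> MV (fun k => Ks (s k)) = MV Ks) /\
  (forall (Ks : 'I_n -> set 'rV[R]_n) (t : 'I_n -> R),
      (forall i, cc_set (Ks i)) -> (forall i, 0 <= t i) ->
      volume (mink_comb t Ks) =
      (\sum_(f : {ffun 'I_n -> 'I_n}) (\prod_(k < n) t (f k)) * MV (fun k => Ks (f k)))%:E).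

Definition MVj (MV : ('I_n -> set 'rV[R]_n) -> R) (j : nat) G K : R :=
  MV (fun k : 'I_n => if (k < n - j)%N then G else K).

Definition d_G (MV : ('I_n -> set 'rV[R]_n) -> R) G K L : R :=
  \sum_(0 <= j < n.+1)
     (2 * MVj MV j G (cchull_union K L) - MVj MV j G K - MVj MV j G L).

End Defs.

(* Main.v *)
(* The mixed volumes MV_j(G, K) are, up to binomial coefficients, the
   coefficients of Vol((1 - t) G + t K) in the Bernstein basis, and every
   Bernstein polynomial of degree n has integral 1 / (n + 1) over [0, 1].
   Hence F(K) := sum_j MV_j(G, K) = (n + 1) * int_0^1 Vol((1 - t) G + t K) dt,
   which is monotone in K without any appeal to the monotonicity of mixed
   volumes.  With H the convex hull of K and L,
   d_G(K, L) = (F(H) - F(K)) + (F(H) - F(L)).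

   Lower bound: if x in L has distance > delta from K, the slice
   (1 - t) G + t H contains, apart from (1 - t) G + t K, a homothetic copy of G
   of ratio proportional to delta, cut off by a hyperplane orthogonal to the
   segment from x to its nearest point in K.

   Upper bound: if G contains the cube of half-width r around p, then H lies in
   K + s (G - p) with s = delta / r, so Vol((1 - t) G + t H) is at most
   Vol((1 - t + t s) G + t K).  This is a polynomial in s whose coefficients are
   bounded uniformly in K (invert a Vandermonde matrix), hence Lipschitz. *)
Require Import Defs.
From HB Require Import structures.
From mathcomp Require Import all_boot all_order all_algebra all_fingroup.
From mathcomp Require Import all_classical all_reals all_analysis.
From mathcomp Require Import polyrcf ring lra.
Import Order.TTheory GRing.Theory Num.Theory.
Import numFieldNormedType.Exports.
Local Open Scope classical_set_scope.
Local Open Scope ring_scope.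
Set Implicit Arguments. Unset Strict Implicit. Unset Printing Implicit Defensive.

(** * The volume as an outer measure *)

Section Boxes.
Context {R : realType} {n : nat}.
Implicit Types (a b c d x v : 'rV[R]_n) (A B : set 'rV[R]_n).

Definition set_coord a (i : 'I_n) (c : R) : 'rV[R]_n :=
  \row_j (if j == i then c else a ord0 j).

Lemma set_coord_eq a i (c : R) : set_coord a i c ord0 i = c.
Proof. by rewrite mxE eqxx. Qed.

Lemma set_coord_neq a i (c : R) j : j != i -> set_coord a i c ord0 j = a ord0 j.
Proof. by rewrite mxE => /negbTE ->. Qed.

Lemma box_vol_cut a b i (c : R) :
  box_vol a b = box_vol a (set_coord b i c) + box_vol (set_coord a i c) b.
Proof.
rewrite /box_vol !(bigD1 (P := xpredT) i)//= !set_coord_eq.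
rewrite [X in _ = _ * X + _](eq_bigr (fun j => b ord0 j - a ord0 j)).
  rewrite [X in _ = _ + _ * X](eq_bigr (fun j => b ord0 j - a ord0 j)).
    by rewrite -mulrDl; congr (_ * _); ring.
  by move=> j ji; rewrite set_coord_neq.
by move=> j ji; rewrite set_coord_neq.
Qed.

Lemma box_vol_ge0 a b : (forall i, a ord0 i <= b ord0 i) -> 0 <= box_vol a b.
Proof. by move=> ab; apply: prodr_ge0 => i _; rewrite subr_ge0. Qed.

Lemma volume_ge0 A : (0 <= volume A)%E.
Proof.
apply: le_ereal_inf_tmp => _ [a [b [ab _ ->]]].
by apply: nneseries_ge0 => k _ _; rewrite lee_fin box_vol_ge0.
Qed.

Lemma le_volume A B : A `<=` B -> (volume A <= volume B)%E.
Proof.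
move=> AB; apply: ereal_inf_le_tmp => _ [a [b [ab Bab ->]]].
by exists a, b; split => //; exact: subset_trans Bab.
Qed.

Lemma box_translate a b v x : box (a + v) (b + v) (x + v) = box a b x.
Proof.
by apply/propext; split => + i => /(_ i); rewrite !mxE !lerD2r.
Qed.

Lemma volume_translate_le A v : (volume [set (x + v)%R | x in A] <= volume A)%E.
Proof.
apply: le_ereal_inf_tmp => _ [a [b [ab Aab ->]]]; apply: ereal_inf_lbound.
exists (fun k => a k + v), (fun k => b k + v); split.
- by move=> k i; rewrite !mxE lerD2r.
- by move=> _ [x /Aab[k _ xk] <-]; exists k => //; rewrite box_translate.
- apply: eq_eseriesr => k _; congr (_%:E); apply: eq_bigr => i _.
  by rewrite !mxE; ring.
Qed.

Lemma volume_translate A v : volume [set x + v | x in A] = volume A.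
Proof.
apply/le_anti/andP; split; first exact: volume_translate_le.
apply: le_trans (volume_translate_le _ (- v)).
by apply: le_volume => x Ax; exists (x + v); rewrite ?addrK//; exists x.
Qed.

Lemma volumeU A B : (volume (A `|` B) <= volume A + volume B)%E.
Proof.
have [/eqP ->|Aoo] := boolP (volume A == +oo%E).
  by rewrite addye ?leey// gt_eqF// (lt_le_trans _ (volume_ge0 B)).
have [/eqP ->|Boo] := boolP (volume B == +oo%E).
  by rewrite addey ?leey// gt_eqF// (lt_le_trans _ (volume_ge0 A)).
have Af : volume A \is a fin_num by rewrite ge0_fin_numE ?volume_ge0// ltey.
have Bf : volume B \is a fin_num by rewrite ge0_fin_numE ?volume_ge0// ltey.
apply/lee_addgt0Pr => e e0.
have e20 : 0 < e / 2 by rewrite divr_gt0.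
have [_ [a [b [ab Aab ->]]] Ae] := lb_ereal_inf_adherent e20 Af.
have [_ [c [d [cd Bcd ->]]] Be] := lb_ereal_inf_adherent e20 Bf.
rewrite [e]splitr EFinD addeACA.
apply: le_trans (leeD (ltW Ae) (ltW Be)).
(* The two covers are interleaved: even indices carry the first, odd indices the second. *)
pose f (u w : nat -> 'rV[R]_n) k := if odd k then w k./2 else u k./2.
have fdef k i : f a c k ord0 i <= f b d k ord0 i by rewrite /f; case: ifP.
apply: (@le_trans _ _ (\sum_(0 <= k <oo) (box_vol (f a c k) (f b d k))%:E)%E).
  apply: ereal_inf_lbound; exists (f a c), (f b d); split => // x [/Aab|/Bcd].
    by move=> [k _ xk]; exists k.*2 => //; rewrite /f odd_double doubleK.
  by move=> [k _ xk]; exists k.*2.+1 => //; rewrite /f /= odd_double uphalf_double.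
have ge1 k : (0 <= (box_vol (a k) (b k))%:E)%E by rewrite lee_fin box_vol_ge0.
have ge2 k : (0 <= (box_vol (c k) (d k))%:E)%E by rewrite lee_fin box_vol_ge0.
have ge3 k : (0 <= (box_vol (f a c k) (f b d k))%:E)%E.
  by rewrite lee_fin box_vol_ge0.
apply: lime_le; first by apply: is_cvg_nneseries => k _ _; exact: ge3.
apply: nearW => N.
apply: (@le_trans _ _
    (\sum_(0 <= k < N.*2) (box_vol (f a c k) (f b d k))%:E)%E).
  by apply: lee_sum_nneg_natr => //; rewrite -addnn leq_addr.
have -> : (\sum_(0 <= k < N.*2) (box_vol (f a c k) (f b d k))%:E =
  \sum_(0 <= k < N) (box_vol (a k) (b k))%:E +
  \sum_(0 <= k < N) (box_vol (c k) (d k))%:E)%E.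
  elim: N => [|N IH]; first by rewrite !big_geq// adde0.
  rewrite doubleS !big_nat_recr//= IH /f /= odd_double /= uphalf_double doubleK.
  by rewrite -addeA addeACA.
apply: leeD.
  by apply: nneseries_lim_ge => k _ _; exact: ge1.
by apply: nneseries_lim_ge => k _ _; exact: ge2.
Qed.

(** Cutting each box of a cover along the hyperplane gives covers of both halves with the same total
    volume. This is the nontrivial half of Carathéodory's condition for half-spaces. *)
Lemma volume_cut A (i : 'I_n) (c : R) :
  (volume (A `&` [set x : 'rV[R]_n | (x ord0 i <= c)%R]) +
   volume (A `&` [set x : 'rV[R]_n | (c <= x ord0 i)%R]) <= volume A)%E.
Proof.
apply: le_ereal_inf_tmp => _ [a [b [ab Aab ->]]].
(* [p k] is [c] moved into the [i]-th side of the [k]-th box, so that both pieces are boxes,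
   possibly degenerate. *)
pose p k := Num.max (a k ord0 i) (Num.min c (b k ord0 i)).
have ap k : a k ord0 i <= p k by rewrite /p le_max lexx.
have pb k : p k <= b k ord0 i by rewrite /p ge_max ab/= ge_min lexx orbT.
pose b' k := set_coord (b k) i (p k); pose a' k := set_coord (a k) i (p k).
have ab' k j : a k ord0 j <= b' k ord0 j by rewrite mxE; case: eqP => [->|].
have a'b k j : a' k ord0 j <= b k ord0 j by rewrite mxE; case: eqP => [->|].
rewrite (@eq_eseriesr _ _ (fun k =>
    (box_vol (a k) (b' k))%:E + (box_vol (a' k) (b k))%:E)%E); last first.
  by move=> k _; rewrite (box_vol_cut (a k) (b k) i (p k)) EFinD.
rewrite nneseriesD; [|by move=> k _ _; rewrite lee_fin box_vol_ge0..].
apply: leeD; apply: ereal_inf_lbound.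
  exists a, b'; split => // x [/Aab[k _ xk]/= xc]; exists k => // j.
  have /andP[-> xb] /= := xk j; rewrite mxE; case: eqP xb => // -> xb.
  by rewrite /p le_max le_min xc xb orbT.
exists a', b; split => // x [/Aab[k _ xk]/= xc]; exists k => // j.
have /andP[ax ->] := xk j; rewrite andbT mxE; case: eqP ax => // -> ax.
by rewrite /p ge_max ax/= ge_min xc.
Qed.

(** Induction on the hyperplanes: after a cut at [c], pairs on the same side are no longer strictly
    separated by it, so the remaining hyperplanes separate them. With none left, [A] or [B] is
    empty, and its volume has to be 0, which fails in dimension 0. *)
Lemma volume_superadd (cuts : seq ('I_n * R)) A B :
  volume (@set0 'rV[R]_n) = 0%E ->
  (forall x y, A x -> B y -> has (fun p : 'I_n * R =>
     (x ord0 p.1 < p.2 < y ord0 p.1) || (y ord0 p.1 < p.2 < x ord0 p.1)) cuts) ->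
  (volume A + volume B <= volume (A `|` B))%E.
Proof.
move=> vol0; elim: cuts A B => [|[i c] cuts IH] A B sep.
  have [->|/set0P[x Ax]] := eqVneq A set0; first by rewrite vol0 add0e set0U.
  have [->|/set0P[y By]] := eqVneq B set0; first by rewrite vol0 adde0 setU0.
  by have := sep _ _ Ax By.
apply: le_trans (volume_cut _ i c).
pose lo := [set x : 'rV[R]_n | x ord0 i <= c].
pose hi := [set x : 'rV[R]_n | c <= x ord0 i].
rewrite -/lo -/hi !setIUl.
have cover S : (volume S <= volume (S `&` lo) + volume (S `&` hi))%E.
  apply: le_trans (volumeU _ _); apply: le_volume => x Sx.
  by have /orP[] := le_total (x ord0 i) c => ?; [left|right].
apply: le_trans (leeD (cover A) (cover B)) _; rewrite addeACA.
by apply: leeD; apply: IH => x y [Ax + ] [By + ]; rewrite /lo /hi /= => xc yc;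
  have /= /orP[/orP[]|//] := sep _ _ Ax By => /andP[h1 h2];
  clear -xc yc h1 h2; lra.
Qed.

(** * A box is not covered by boxes of smaller total volume *)

Definition clamp (a b x : R) : R := Num.max a (Num.min x b).

Lemma clampP (a b x : R) : a <= b ->
  [\/ x <= a /\ clamp a b x = a, a <= x <= b /\ clamp a b x = x
    | b <= x /\ clamp a b x = b].
Proof.
move=> ab; rewrite /clamp.
have [xb|bx] := leP x b; last by constructor 3; rewrite max_r// (ltW bx).
have [ax|xa] := leP a x; first by constructor 2.
by constructor 1; rewrite (ltW xa).
Qed.

Lemma clamp_lip (a b x y : R) : a <= b -> x <= y ->
  0 <= clamp a b y - clamp a b x <= y - x.
Proof.
move=> ab xy; have := clampP x ab; have := clampP y ab.
move=> [[?->]|[/andP[? ?]->]|[?->]] [[?->]|[/andP[? ?]->]|[?->]];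
  apply/andP; split; lra.
Qed.

Lemma clamp_cut (a b c x : R) : a <= c <= b ->
  clamp a b x = clamp a c x + clamp c b x - c.
Proof.
move=> /andP[ac cb]; have ab := le_trans ac cb.
have := clampP x ab; have := clampP x ac; have := clampP x cb.
move=> [[?->]|[/andP[? ?]->]|[?->]] [[?->]|[/andP[? ?]->]|[?->]]
       [[?->]|[/andP[? ?]->]|[?->]]; lra.
Qed.

(** For ordered corners this is the volume of the intersection of the boxes [[a, b]] and [[c, d]],
    in a form that is visibly additive under cuts of [[a, b]]. *)
Definition box_meet_vol a b (c d : 'rV[R]_n) : R :=
  \prod_(i < n) (clamp (a ord0 i) (b ord0 i) (d ord0 i) -
                 clamp (a ord0 i) (b ord0 i) (c ord0 i)).

Lemma box_meet_vol_bounds a b c d : (forall i, a ord0 i <= b ord0 i) ->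
  (forall i, c ord0 i <= d ord0 i) ->
  0 <= box_meet_vol a b c d <= box_vol c d.
Proof.
move=> ab cd; apply/andP; split.
  by apply: prodr_ge0 => i _; have /andP[] := clamp_lip (ab i) (cd i).
by apply: ler_prod => i _; exact: clamp_lip.
Qed.

Lemma box_meet_vol_sub a b c d : (forall i, a ord0 i <= b ord0 i) ->
  (forall i, c ord0 i <= a ord0 i) -> (forall i, b ord0 i <= d ord0 i) ->
  box_meet_vol a b c d = box_vol a b.
Proof.
move=> ab ca bd; apply: eq_bigr => i _; rewrite /clamp.
rewrite (min_r (bd i)) (max_r (ab i)).
by rewrite (min_l (le_trans (ca i) (ab i))) (max_l (ca i)).
Qed.

Lemma box_meet_vol_cut a b c d i p : a ord0 i <= p <= b ord0 i ->
  box_meet_vol a b c d =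
  box_meet_vol a (set_coord b i p) c d + box_meet_vol (set_coord a i p) b c d.
Proof.
move=> apb.
rewrite /box_meet_vol !(bigD1 (P := xpredT) i)//= !set_coord_eq.
set P := (X in _ * X = _).
rewrite [X in _ = _ * X + _](_ : _ = P); last first.
  by apply: eq_bigr => j ji; rewrite !set_coord_neq.
rewrite [X in _ = _ + _ * X](_ : _ = P); last first.
  by apply: eq_bigr => j ji; rewrite !set_coord_neq.
by rewrite -mulrDl !(clamp_cut _ apb); congr (_ * _); ring.
Qed.

Section Bisection.
Variables c d : nat -> 'rV[R]_n.
Hypothesis cd : forall k i, c k ord0 i <= d k ord0 i.

Definition undercovered a b := (forall i, a ord0 i <= b ord0 i) /\
  (\sum_(0 <= k <oo) (box_meet_vol a b (c k) (d k))%:E < (box_vol a b)%:E)%E.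

(** Both sides of the strict inequality are additive under the cut, so it cannot fail on both
    pieces. *)
Lemma undercovered_cut a b i p : a ord0 i <= p <= b ord0 i ->
  undercovered a b ->
  undercovered a (set_coord b i p) \/ undercovered (set_coord a i p) b.
Proof.
move=> /andP[ap pb] [ab lt_ab].
have ab' j : a ord0 j <= set_coord b i p ord0 j by rewrite mxE; case: eqP => [->|].
have a'b j : set_coord a i p ord0 j <= b ord0 j by rewrite mxE; case: eqP => [->|].
apply: contrapT => /not_orP[n1 n2].
have {}n1 : ((box_vol a (set_coord b i p))%:E <=
    \sum_(0 <= k <oo) (box_meet_vol a (set_coord b i p) (c k) (d k))%:E)%E.
  by rewrite leNgt; apply/negP => h; apply: n1.
have {}n2 : ((box_vol (set_coord a i p) b)%:E <=
    \sum_(0 <= k <oo) (box_meet_vol (set_coord a i p) b (c k) (d k))%:E)%E.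
  by rewrite leNgt; apply/negP => h; apply: n2.
move: lt_ab; rewrite ltNge => /negP; apply.
rewrite (box_vol_cut a b i p) EFinD.
rewrite (@eq_eseriesr _ _ (fun k =>
    (box_meet_vol a (set_coord b i p) (c k) (d k))%:E +
    (box_meet_vol (set_coord a i p) b (c k) (d k))%:E)%E); last first.
  by move=> k _; rewrite (@box_meet_vol_cut _ _ _ _ i p) ?EFinD ?ap.
rewrite nneseriesD; first exact: leeD.
  by move=> k _ _; rewrite lee_fin; have /andP[] := box_meet_vol_bounds ab' (cd k).
by move=> k _ _; rewrite lee_fin; have /andP[] := box_meet_vol_bounds a'b (cd k).
Qed.

Lemma undercovered_half a b : undercovered a b ->
  exists a' b', [/\ undercovered a' b', forall i, a ord0 i <= a' ord0 i,
    forall i, b' ord0 i <= b ord0 i &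
    forall i, b' ord0 i - a' ord0 i = (b ord0 i - a ord0 i) / 2].
Proof.
move=> uab.
(* The coordinates are halved one at a time; [m] counts those already done. *)
suff /(_ n (leqnn n))[a' [b' [u' aa' b'b half]]] : forall m, (m <= n)%N ->
    exists a' b', [/\ undercovered a' b', forall i, a ord0 i <= a' ord0 i,
    forall i, b' ord0 i <= b ord0 i &
    forall i, b' ord0 i - a' ord0 i =
      (b ord0 i - a ord0 i) / (if (i < m)%N then 2 else 1)].
  by exists a', b'; split => // i; rewrite half ltn_ord.
elim=> [_|m IH mn].
  by exists a, b; split => // i; rewrite divr1.
have [a' [b' [u' aa' b'b half]]] := IH (ltnW mn).
pose i0 := Ordinal mn; pose p := (a' ord0 i0 + b' ord0 i0) / 2.
have ab0 := u'.1 i0.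
have hp : a' ord0 i0 <= p <= b' ord0 i0 by apply/andP; rewrite /p; split; lra.
have hi0 := half i0; rewrite /= ltnn divr1 in hi0.
have hs i : i != i0 -> (i < m.+1)%N = (i < m)%N.
  move=> ii0; have ne : (i : nat) != m.
    by apply: contra ii0 => /eqP im; apply/eqP/val_inj.
  by rewrite ltnS leq_eqVlt (negbTE ne).
have [u1|u1] := undercovered_cut hp u'.
  exists a', (set_coord b' i0 p); split => // i; rewrite mxE.
    by case: eqP => // ->; apply: le_trans (b'b i0); case/andP: hp.
  case: eqVneq => [->|/hs ->//]; rewrite ltnSn -hi0 /p; lra.
exists (set_coord a' i0 p), b'; split => // i; rewrite mxE.
  by case: eqP => // ->; apply: le_trans (aa' i0) _; case/andP: hp.
case: eqVneq => [->|/hs ->//]; rewrite ltnSn -hi0 /p; lra.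
Qed.

Lemma undercovered_small a b N : undercovered a b ->
  exists a' b', [/\ undercovered a' b', forall i, a ord0 i <= a' ord0 i,
    forall i, b' ord0 i <= b ord0 i &
    forall i, b' ord0 i - a' ord0 i = (b ord0 i - a ord0 i) / 2 ^+ N].
Proof.
move=> uab; elim: N => [|N [a1 [b1 [u1 a1a bb1 h1]]]].
  by exists a, b; split => // i; rewrite divr1.
have [a2 [b2 [u2 a2a bb2 h2]]] := undercovered_half u1.
exists a2, b2; split => // i.
- exact: le_trans (a2a i).
- exact: le_trans (bb1 i).
- by rewrite h2 h1 exprSr invfM mulrA.
Qed.

(* A small undercovered box near a cluster point [x] of the bisection lies
   inside the open box covering [x], which covers it entirely. *)
Lemma not_undercovered a b :
  box a b `<=` \bigcup_k [set x | forall i, c k ord0 i < x ord0 i < d k ord0 i] ->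
  ~ undercovered a b.
Proof.
move=> cov uab.
have /choice[u hu] : forall N : nat, exists a', exists b',
    [/\ undercovered a' b', forall i, a ord0 i <= a' ord0 i,
    forall i, b' ord0 i <= b ord0 i &
    forall i, b' ord0 i - a' ord0 i = (b ord0 i - a ord0 i) / 2 ^+ N].
  by move=> N; exact: undercovered_small.
have cbox : compact (box a b).
  rewrite (_ : box a b =
      [set v : 'rV[R]_n | forall i, `[a ord0 i, b ord0 i]%classic (v ord0 i)]).
    apply: (@rV_compact R n (fun i => `[a ord0 i, b ord0 i]%classic)) => i.
    exact: segment_compact.
  by apply/seteqP; split => x xab i; have := xab i; rewrite /= in_itv.
have ubox N : box a b (u N).
  have [b' [[ab' _] aa' b'b _]] := hu N => i.
  by rewrite aa' (le_trans (ab' i)).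
have [|x [xab clx]] := @cbox (u @ \oo) _.
  by exists 0%N => // N _; exact: ubox.
have [k _ xk] := cov _ xab.
(* The margin is [e] below and [2 e] above: the corner [u N] will be within [e] of [x], and the
   sides of its box shorter than [e]. *)
have /= [e e0 he] : exists2 e : R, 0 < e &
    forall i, c k ord0 i + e < x ord0 i < d k ord0 i - e - e.
  have : \forall e \near 0^'+, 0 < e /\
      forall i, c k ord0 i + e < x ord0 i < d k ord0 i - e - e.
    near=> e; split=> //.
    near: e; apply: filter_forall => i.
    have /andP[ci di] := xk i.
    pose m := Num.min (x ord0 i - c k ord0 i) ((d k ord0 i - x ord0 i) / 2).
    have m0 : 0 < m by rewrite lt_min subr_gt0 ci divr_gt0// subr_gt0.
    near=> e; have : e < m by near: e; exact: nbhs_right_lt.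
    by rewrite lt_min => /andP[? ?]; apply/andP; split; lra.
  by case/filter_ex => e [e0 he]; exists e.
have : \forall N \near \oo, forall i, (b ord0 i - a ord0 i) / 2 ^+ N < e.
  apply: filter_forall => i.
  have : (fun N : nat => (b ord0 i - a ord0 i) / 2 ^+ N) @ \oo --> (0 : R).
    rewrite (_ : (fun _ => _) = geometric (b ord0 i - a ord0 i) 2^-1).
      by apply: cvg_geometric; rewrite ger0_norm ?invr_ge0// invf_lt1 ?ltr1n.
    by apply/funext => N; rewrite /geometric /= exprVn.
  by move/cvgr_lt; apply.
move=> [N0 _ small].
have [_ [[N N0N <-] /=]] := clx [set u N | N in [set N | (N0 <= N)%N]] _
  (ex_intro2 _ _ N0 I (fun N h => ex_intro2 _ _ N h erefl))
  (nbhsx_ballx x e e0).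
rewrite -ball_normE /= => xu.
have [b' [[ab' lt'] aa' b'b side]] := hu N.
have near_i i : `|x ord0 i - u N ord0 i| < e.
  apply: le_lt_trans xu; rewrite [leRHS]/Num.norm/= mx_normrE.
  by apply/bigmax_geP; right; exists (ord0, i); rewrite //= !mxE.
move: lt'; rewrite ltNge => /negP; apply.
rewrite -(@box_meet_vol_sub (u N) b' (c k) (d k))//.
- apply: le_trans (nneseries_lim_ge k.+1 _).
    rewrite big_nat_recr//= leeDr// sume_ge0// => j _.
    by rewrite lee_fin; have /andP[] := box_meet_vol_bounds ab' (cd j).
  by move=> j _ _; rewrite lee_fin; have /andP[] := box_meet_vol_bounds ab' (cd j).
- move=> i; have := near_i i; have := he i => /andP[? ?].
  by rewrite ltr_norml => /andP[? ?]; lra.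
- move=> i; have := near_i i; have := he i => /andP[? ?].
  rewrite ltr_norml => /andP[? ?].
  have := side i; have := small N N0N i; lra.
Unshelve. all: by end_near. Qed.

End Bisection.

(** The volume of the enlarged box is a polynomial in [h], hence continuous at 0. This replaces
    closed boxes by open ones at small cost. *)
Lemma box_enlarge_vol a b (e : R) : 0 < e ->
  exists2 h : R, 0 < h &
    box_vol (a - const_mx h) (b + const_mx h) <= box_vol a b + e.
Proof.
move=> e0.
pose p : {poly R} := \prod_(i < n) ((b ord0 i - a ord0 i)%:P + 2 *: 'X).
have pE h : p.[h] = box_vol (a - const_mx h) (b + const_mx h).
  by rewrite horner_prod; apply: eq_bigr => i _; rewrite !hornerE !mxE; ring.
have p0 : p.[0] = box_vol a b.
  by rewrite horner_prod; apply: eq_bigr => i _; rewrite !hornerE; ring.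
have [h h0 hp] := poly_cont 0 p e0.
exists (h / 2); first by rewrite divr_gt0.
rewrite -pE -p0 -lerBlDl; apply: le_trans (ler_norm _) (ltW (hp _ _)).
by rewrite subr0 gtr0_norm; lra.
Qed.

Lemma volume_box a b : (forall i, a ord0 i <= b ord0 i) ->
  ((box_vol a b)%:E <= volume (box a b))%E.
Proof.
move=> ab; apply: le_ereal_inf_tmp => _ [c [d [cd cov ->]]].
apply/lee_addgt0Pr => e e0.
(* The [k]-th box is enlarged at cost [e / 2 ^ k.+1], so the total cost is at most [e]. *)
have /choice[h hh] : forall k : nat, exists h : R, 0 < h /\
    box_vol (c k - const_mx h) (d k + const_mx h) <=
    box_vol (c k) (d k) + e / (2 ^ k.+1)%:R.
  move=> k; have ek : 0 < e / (2 ^ k.+1)%:R.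
    by rewrite divr_gt0// ltr0n expn_gt0.
  by have [h h0 hle] := box_enlarge_vol (c k) (d k) ek; exists h.
pose c' k := c k - const_mx (h k); pose d' k := d k + const_mx (h k).
have cd' k i : c' k ord0 i <= d' k ord0 i.
  by rewrite !mxE; have := (hh k).1; have := cd k i; lra.
have /not_undercovered : box a b `<=`
    \bigcup_k [set x | forall i, c' k ord0 i < x ord0 i < d' k ord0 i].
  move=> x /cov[k _ xk]; exists k => // i; have /andP[? ?] := xk i.
  by rewrite !mxE; have := (hh k).1 => ?; apply/andP; split; lra.
move=> /(_ cd'); rewrite /undercovered => nu.
have {}nu : ((box_vol a b)%:E <=
    \sum_(0 <= k <oo) (box_meet_vol a b (c' k) (d' k))%:E)%E.
  by rewrite leNgt; apply/negP => lt; apply: nu.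
apply: (le_trans nu).
apply: le_trans (epsilon_trick xpredT _ (ltW e0)); last first.
  by move=> k; rewrite lee_fin box_vol_ge0.
apply: lee_nneseries => k _.
  by move=> _; rewrite lee_fin; have /andP[] := box_meet_vol_bounds ab (cd' k).
rewrite -EFinD lee_fin; apply: le_trans (hh k).2.
by have /andP[] := box_meet_vol_bounds ab (cd' k).
Qed.

End Boxes.

(** * Polynomials *)

Section PolynomialIntegral.
Context {R : realType}.
Implicit Types (p q : {poly R}).

(* The constant coefficient is [p`_0 / 0 = 0]. *)
Definition primitive p : {poly R} :=
  \poly_(i < (size p).+1) (p`_i.-1 / i%:R).

Definition integral01 p : R := (primitive p).[1] - (primitive p).[0].

Lemma deriv_primitive p : (primitive p)^`() = p.
Proof.
apply/polyP => i; rewrite coef_deriv coef_poly ltnS /=.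
case: ltnP => [_|/leq_sizeP ->//]; last by rewrite mul0rn.
by rewrite -[LHS]mulr_natr divfK// pnatr_eq0.
Qed.

(** Two antiderivatives differ by a constant, by the mean value theorem. *)
Lemma integral01E p q : q^`() = p -> integral01 p = q.[1] - q.[0].
Proof.
move=> qp; have [x _] := poly_mvt (primitive p - q) (@ltr01 R).
rewrite derivB deriv_primitive qp subrr horner0 mul0r !hornerE /integral01.
by lra.
Qed.

Lemma integral01_sum (I : Type) (r : seq I) (P : pred I) (c : I -> R)
    (f : I -> {poly R}) :
  integral01 (\sum_(i <- r | P i) c i *: f i) =
  \sum_(i <- r | P i) c i * integral01 (f i).
Proof.
rewrite (@integral01E _ (\sum_(i <- r | P i) c i *: primitive (f i))).
  rewrite !horner_sum -sumrB; apply: eq_bigr => i _.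
  by rewrite !hornerZ -mulrBr.
rewrite raddf_sum; apply: eq_bigr => i _.
by rewrite /= derivZ deriv_primitive.
Qed.

Lemma integral01B p q : integral01 (p - q) = integral01 p - integral01 q.
Proof.
rewrite (@integral01E _ (primitive p - primitive q)) ?derivB ?deriv_primitive//.
by rewrite !hornerE /integral01; ring.
Qed.

(** The mean value theorem on [[0, 1/2]], [[1/2, 3/4]] and [[3/4, 1]]. On the middle interval [t] is
    at least 1/2 and [1 - t] at least 1/4, as the lower estimate of the slices requires. *)
Lemma integral01_ge p (c : R) : (forall t, 0 <= t <= 1 -> 0 <= p.[t]) ->
  (forall t, 1/2 <= t <= 3/4 -> c <= p.[t]) -> c / 4 <= integral01 p.
Proof.
move=> p0 pc; pose P := primitive p; rewrite /integral01 -/P.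
have mvt a b d : a < b -> (forall t, a <= t <= b -> d <= p.[t]) ->
    d * (b - a) <= P.[b] - P.[a].
  move=> ab pd; have [t] := poly_mvt P ab.
  rewrite in_itv/= => /andP[at_ tb] ->; rewrite deriv_primitive.
  by rewrite ler_wpM2r ?subr_ge0 ?(ltW ab)// pd// (ltW at_) (ltW tb).
have h1 : 0 * (1/2 - 0) <= P.[1/2] - P.[0].
  by apply: mvt => [|t /andP[? ?]]; [lra|apply: p0; apply/andP; split; lra].
have h2 : c * (3/4 - 1/2) <= P.[3/4] - P.[1/2] by apply: mvt => //; lra.
have h3 : 0 * (1 - 3/4) <= P.[1] - P.[3/4].
  by apply: mvt => [|t /andP[? ?]]; [lra|apply: p0; apply/andP; split; lra].
by lra.
Qed.

(** Beta integral, by induction on [a]: integration by parts trades a factor [1 - 'X] for a factor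
    ['X]. *)
Lemma integral01_beta a b :
  integral01 ((1 - 'X) ^+ a * 'X^b) * ('C(a + b, b) * (a + b).+1)%:R = 1.
Proof.
elim: a b => [|a IH] b.
  rewrite expr0 mul1r add0n binn mul1n.
  rewrite (@integral01E _ ((b.+1%:R : R)^-1 *: 'X^(b.+1))); last first.
    rewrite derivZ derivXn -[X in _ *: X]scaler_nat scalerA.
    by rewrite mulVf ?pnatr_eq0// scale1r.
  rewrite !hornerZ !hornerXn expr1n expr0n /= mulr0 subr0 mulr1.
  by rewrite mulVf// pnatr_eq0.
pose f (k l : nat) : {poly R} := (1 - 'X) ^+ k * 'X^l.
have parts : b.+1%:R * integral01 (f a.+1 b) = a.+1%:R * integral01 (f a b.+1).
  apply/eqP; rewrite -subr_eq0; apply/eqP.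
  have := @integral01_sum bool [:: true; false] xpredT
    (fun x => if x then b.+1%:R else - a.+1%:R)
    (fun x => if x then f a.+1 b else f a b.+1).
  rewrite !big_cons !big_nil !addr0 mulNr => <-.
  (* The product [f a.+1 b.+1] is an antiderivative of the difference and vanishes at 0 and at 1. *)
  rewrite (@integral01E _ (f a.+1 b.+1)).
    by rewrite /f !hornerE subrr !exprS !mul0r mulr0 subr0.
  rewrite /f derivM derivXn deriv_exp derivB derivC derivX /= sub0r.
  rewrite scaleNr !scaler_nat; ring.
have := IH b.+1; rewrite -/(f a b.+1) -/(f a.+1 b) addnS addSn !natrM.
have := mul_bin_left (a + b).+1 b.
rewrite -addSn addnK => /(congr1 (fun k => k%:R : R)).
rewrite !natrM addSn; move: parts.
set C1 := ('C(_, b.+1)%:R); set C2 := ('C(_, b)%:R); set J := integral01 _.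
set J' := integral01 _; set N := ((_.+2)%:R).
have : (b.+1%:R : R) != 0 by rewrite pnatr_eq0.
move: (b.+1%:R : R) (a.+1%:R : R) => x y x0 parts binE IHb.
apply: (mulfI x0); rewrite mulr1.
transitivity ((x * J) * (C2 * N)); first by ring.
transitivity (J' * (y * C2) * N); first by rewrite parts; ring.
by rewrite -binE -[RHS]mulr1 -IHb; ring.
Qed.

End PolynomialIntegral.

(** * Bounds for coefficients and for differences of powers *)

Section PolynomialBounds.
Context {R : realType}.

Lemma coef_bound (m : nat) : exists2 C : R, 0 <= C &
  forall (c : 'I_m.+1 -> R) (M : R), 0 <= M ->
    (forall t : 'I_m.+1, `|\sum_(j < m.+1) c j * t%:R ^+ j| <= M) ->
    forall j, `|c j| <= C * M.
Proof.
pose V := Vandermonde m.+1 (\row_(j < m.+1) (j%:R : R)).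
have Vu : V \in unitmx.
  rewrite unitmxE det_Vandermonde unitfE; apply/prodf_neq0 => i _.
  apply/prodf_neq0 => j ij; rewrite !mxE subr_eq0 eqr_nat.
  by rewrite gtn_eqF.
(* The sum of all entries of the inverse, in absolute value, serves every coefficient at once. *)
exists (\sum_(i < m.+1) \sum_(j < m.+1) `|invmx V i j|).
  by apply: sumr_ge0 => i _; apply: sumr_ge0 => j _.
move=> c M M0 hM j.
have cV : (\row_j c j) = ((\row_j c j) *m V) *m invmx V by rewrite mulmxK.
have -> : c j = ((\row_j c j) *m V *m invmx V) ord0 j by rewrite -cV mxE.
rewrite mxE; apply: le_trans (ler_norm_sum _ _ _) _.
rewrite mulr_suml; apply: ler_sum => i _; rewrite normrM mulrC.
apply: ler_pM => //.
  by rewrite (bigD1 j)//= lerDl sumr_ge0.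
apply: le_trans (hM i); rewrite mxE le_eqVlt; apply/orP; left; apply/eqP.
by congr `|_|; apply: eq_bigr => k _; rewrite !mxE.
Qed.

Lemma expr_lip (m : nat) (x y : R) : 0 <= x -> x <= y -> y <= 2 ->
  y ^+ m - x ^+ m <= (y - x) * (m%:R * 2 ^+ m).
Proof.
move=> x0 xy y2; elim: m => [|m IH]; first by rewrite !expr0 mul0r mulr0 subrr.
have -> : y ^+ m.+1 - x ^+ m.+1 = y * (y ^+ m - x ^+ m) + (y - x) * x ^+ m.
  by rewrite !exprS; ring.
have h1 : 0 <= y ^+ m - x ^+ m.
  by rewrite subr_ge0; apply: lerXn2r; rewrite ?nnegrE; lra.
have h2 : x ^+ m <= 2 ^+ m by apply: lerXn2r; rewrite ?nnegrE; lra.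
have h3 : 0 <= 2 ^+ m :> R by rewrite exprn_ge0.
have h4 : (y - x) * x ^+ m <= (y - x) * 2 ^+ m by rewrite ler_wpM2l// subr_ge0.
have h5 : y * (y ^+ m - x ^+ m) <= 2 * ((y - x) * (m%:R * 2 ^+ m)).
  by apply: ler_pM => //; lra.
have h6 : 0 <= (y - x) * 2 ^+ m by rewrite mulr_ge0// subr_ge0.
rewrite -natr1 exprS; lra.
Qed.

End PolynomialBounds.

(** * Minkowski combinations of two bodies *)

Section Minkowski.
Context {R : realType}.

Definition mink2 n (a : R) (A : set 'rV[R]_n) (b : R) (B : set 'rV[R]_n) :
    set 'rV[R]_n :=
  [set a *: x + b *: y | x in A & y in B].

Lemma convex_mink2 n (a b : R) (A B : set 'rV[R]_n) :
  Defs.convex_set A -> Defs.convex_set B -> Defs.convex_set (mink2 a A b B).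
Proof.
move=> cA cB _ _ t [x Ax [y By <-]] [x' Ax' [y' By' <-]] t01.
exists (t *: x + (1 - t) *: x'); first exact: cA.
exists (t *: y + (1 - t) *: y'); first exact: cB.
by apply/rowP => i; rewrite !mxE; ring.
Qed.

Lemma volume_box_le n (a b : 'rV[R]_n.+1) : (forall i, a ord0 i <= b ord0 i) ->
  (volume (box a b) <= (box_vol a b)%:E)%E.
Proof.
move=> ab; apply: ereal_inf_lbound.
(* All boxes after the first are the degenerate [[a, a]], of volume 0 in positive dimension. *)
exists (fun=> a), (fun k => if k is 0 then b else a); split.
- by move=> [|k] i.
- by move=> x xab; exists 0%N.
- rewrite (nneseries_split _ 1); last first.
    by move=> [|k] _; rewrite lee_fin box_vol_ge0.
  rewrite add0n big_nat1 eseries0 ?adde0// => -[//|k] _ _.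
  by rewrite /box_vol big_ord_recl subrr mul0r.
Qed.

Lemma volume_boxE n (a b : 'rV[R]_n.+1) : (forall i, a ord0 i <= b ord0 i) ->
  volume (box a b) = (box_vol a b)%:E.
Proof.
by move=> ab; apply/le_anti; rewrite volume_box_le//= volume_box.
Qed.

Lemma volume0 n : volume (@set0 'rV[R]_n.+1) = 0%E.
Proof.
apply/le_anti; rewrite volume_ge0 andbT.
apply: (@le_trans _ _ (volume (box (0 : 'rV[R]_n.+1) 0))); first exact: le_volume.
by rewrite volume_boxE// /box_vol big_ord_recl subrr mul0r.
Qed.

(** * Intervals on the line *)

Section DimensionOne.
Implicit Types (A B : set 'rV[R]_1).

Lemma convex_box_sub1 A (u v : 'rV[R]_1) :
  Defs.convex_set A -> A u -> A v -> box u v `<=` A.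
Proof.
move=> cA Au Av x /(_ ord0) /andP[ux xv].
have [uv|uv] := eqVneq (u ord0 ord0) (v ord0 ord0).
  suff -> : x = u by [].
  by apply/rowP => i; rewrite ord1; apply/le_anti; rewrite ux uv xv.
have uv0 : 0 < v ord0 ord0 - u ord0 ord0.
  by rewrite subr_gt0 lt_neqAle uv (le_trans ux).
pose t := (v ord0 ord0 - x ord0 ord0) / (v ord0 ord0 - u ord0 ord0).
have -> : x = t *: u + (1 - t) *: v.
  apply/rowP => i; rewrite ord1 !mxE /t.
  by field; rewrite gt_eqF.
apply: cA => //; rewrite /t divr_ge0 ?ler_pdivrMr ?(ltW uv0) ?subr_ge0//=.
by rewrite mul1r lerD2l lerN2.
Qed.

Lemma cc_set1 A : cc_set A -> exists u v, [/\ A u, A v,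
  u ord0 ord0 <= v ord0 ord0 & A = box u v].
Proof.
move=> [cpA [cA A0]].
have cf : {within A, continuous (fun x : 'rV[R]_1 => x ord0 ord0)}.
  by apply: continuous_subspaceT => x; exact: coord_continuous.
have [u /set_mem Au umin] := compact_EVT_min A0 cpA cf.
have [v /set_mem Av vmax] := compact_EVT_max A0 cpA cf.
exists u, v; split => //; first exact/umin/mem_set.
apply/seteqP; split; last exact: convex_box_sub1.
move=> x /mem_set Ax i; rewrite (ord1 i).
by apply/andP; split; [exact: umin|exact: vmax].
Qed.

(** In dimension 1, [is_mixed_volume] speaks of multiples of a single body, so the formula for two
    bodies is computed from intervals. *)
Lemma volume_mink2_dim1 A B (a b : R) : cc_set A -> cc_set B ->
  0 <= a -> 0 <= b ->
  volume (mink2 a A b B) = (a%:E * volume A + b%:E * volume B)%E.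
Proof.
move=> ccA ccB a0 b0.
have [u [v [Au Av uv AE]]] := cc_set1 ccA.
have [w [z [Bw Bz wz BE]]] := cc_set1 ccB.
have -> : mink2 a A b B = box (a *: u + b *: w) (a *: v + b *: z).
  apply/seteqP; split.
    move=> _ [x Ax [y By <-]] i; rewrite (ord1 i) !mxE.
    move: Ax By; rewrite AE BE => /(_ ord0)/andP[? ?] /(_ ord0)/andP[? ?].
    by apply/andP; split; apply: lerD; exact: ler_wpM2l.
  apply: convex_box_sub1.
  - by apply: convex_mink2; [exact: ccA.2.1|exact: ccB.2.1].
  - by exists u => //; exists w.
  - by exists v => //; exists z.
rewrite {1}AE {1}BE !volume_boxE.
- rewrite -!EFinM -EFinD /box_vol !big_ord1 !mxE; congr (_%:E); ring.
- by move=> i; rewrite (ord1 i).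
- by move=> i; rewrite (ord1 i).
- by move=> i; rewrite (ord1 i) !mxE; apply: lerD; exact: ler_wpM2l.
Qed.

End DimensionOne.

(** * Volume of a combination of two bodies as a polynomial *)

Section TwoBodies.
Variable (n : nat) (MV : ('I_n -> set 'rV[R]_n) -> R).
Hypothesis hMV : is_mixed_volume MV.
Implicit Types (A B : set 'rV[R]_n).

Lemma perm_eq_bool (s1 s2 : seq bool) :
  size s1 = size s2 -> count id s1 = count id s2 -> perm_eq s1 s2.
Proof.
move=> szE ctE.
have ctrue : count_mem true s1 = count_mem true s2.
  by rewrite -[LHS](@eq_count _ id) 1?ctE; [apply: eq_count|]; case.
apply/allP => -[] _ /=; apply/eqP => //.
have cf s : count_mem false s = (size s - count_mem true s)%N.
  rewrite -(count_predC (pred1 true)) addnC addnK.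
  by apply: eq_count; case.
by rewrite !cf szE ctrue.
Qed.

(** By symmetry only the number of entries equal to [B] matters: the indicator of [S] and the
    pattern in [MVj] are rearrangements of each other. *)
Lemma MV_set A B (S : {set 'I_n}) : cc_set A -> cc_set B ->
  MV (fun k => if k \in S then B else A) = MVj MV #|S| A B.
Proof.
move=> ccA ccB.
have Sn : (#|S| <= n)%N by rewrite -[leqRHS]card_ord max_card.
pose t1 := [tuple of map (fun k : 'I_n => (n - #|S| <= k)%N) (ord_tuple n)].
pose t2 := [tuple of map (mem S) (ord_tuple n)].
have : perm_eq t1 t2.
  apply: perm_eq_bool; rewrite ?size_tuple// !count_map /=.
  transitivity #|S|; last by rewrite cardE /enum_mem size_filter; apply: eq_count.
  rewrite -enumT -(@eq_count _ (preim val (leq (n - #|S|))))//.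
  rewrite -count_map val_enum_ord -[X in iota _ X](subnK Sn) iotaD count_cat add0n.
  rewrite (@eq_in_count _ _ pred0); last first.
    by move=> k; rewrite mem_iota add0n => /andP[_ kS]; rewrite /= leqNgt kS.
  rewrite count_pred0 add0n (@eq_in_count _ _ predT) ?count_predT ?size_iota//.
  by move=> k; rewrite mem_iota => /andP[].
move=> /tuple_permP[s t12].
have sE k : (s k \in S) = ~~ (k < n - #|S|)%N.
  have := congr1 (fun u => nth false u k) t12.
  rewrite -!tnth_nth !tnth_map !tnth_ord_tuple /= => <-.
  by rewrite -leqNgt.
have Kcc k : cc_set (if k \in S then B else A) by case: ifP.
rewrite -(hMV.1 (fun k => if k \in S then B else A) s Kcc) /MVj.
by congr MV; apply/funext => k; rewrite sE; case: ltnP.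
Qed.

Lemma sum_subsets (F : nat -> R) :
  \sum_(S : {set 'I_n}) F #|S| = \sum_(j < n.+1) 'C(n, j)%:R * F j.
Proof.
have Sn (S : {set 'I_n}) : (#|S| < n.+1)%N.
  by rewrite ltnS -[leqRHS]card_ord max_card.
rewrite (partition_big (fun S => Ordinal (Sn S)) xpredT)//=.
apply: eq_bigr => j _.
rewrite (eq_bigr (fun=> F j)); last by move=> S /eqP <-.
rewrite sumr_const mulr_natl; congr (_ *+ _).
rewrite -[X in 'C(X, _)](card_ord n) -card_draws -sum1_card -[RHS]sum1_card.
by apply: eq_bigl => S; rewrite inE.
Qed.

End TwoBodies.

(** [A] and [B] occupy two indices and all others get weight 0. The surviving terms are indexed by
    maps into these two indices, that is by subsets, which are grouped by cardinality. Dimension 1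
    has a single index and is treated apart. *)
Lemma volume_mink2 (n : nat) (MV : ('I_n.+1 -> set 'rV[R]_n.+1) -> R)
    (A B : set 'rV[R]_n.+1) (a b : R) :
  is_mixed_volume MV -> cc_set A -> cc_set B -> 0 <= a -> 0 <= b ->
  volume (mink2 a A b B) = (\sum_(j < n.+2)
    'C(n.+1, j)%:R * (a ^+ (n.+1 - j) * b ^+ j * MVj MV j A B))%:E.
Proof.
move=> hMV ccA ccB a0 b0; case: n => [|n] in MV A B hMV ccA ccB *.
  have MV1 K : cc_set K -> volume K = (MV (fun=> K))%:E.
    move=> ccK.
    have := hMV.2 (fun=> K) (fun=> 1) (fun=> ccK) (fun=> ler01).
    rewrite (_ : mink_comb _ _ = K); last first.
      apply/seteqP; split => [_ [x [xK ->]]|x Kx].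
        by rewrite big_ord1 scale1r.
      by exists (fun=> x); rewrite big_ord1 scale1r.
    move=> ->; congr (_%:E).
    rewrite (eq_bigr (fun=> MV (fun=> K))); last first.
      by move=> f _; rewrite big_ord1 mul1r.
    by rewrite sumr_const card_ffun !card_ord expn1.
  rewrite volume_mink2_dim1// !MV1// -!EFinM -EFinD; congr (_%:E).
  rewrite !big_ord_recl big_ord0 addr0 /= /bump /= add1n.
  rewrite bin0 bin1 subn0 subnn !expr0 !expr1 !mul1r mulr1.
  by congr (_ * _ + _ * _); rewrite /MVj; congr MV; apply/funext => k;
    rewrite ord1.
pose i0 : 'I_n.+2 := ord0; pose i1 : 'I_n.+2 := lift ord0 ord0.
have i10 : i1 != i0 by [].
(* The idle indices carry a copy of [A], so that every [Ks i] is a nonempty compact convex set. *)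
pose Ks i := if i == i1 then B else A.
pose t i := if i == i1 then b else if i == i0 then a else 0.
have ccK i : cc_set (Ks i) by rewrite /Ks; case: ifP.
have t0 i : 0 <= t i by rewrite /t; do 2?[case: ifP => //].
have tsum (x : 'I_n.+2 -> 'rV[R]_n.+2) :
    \sum_i t i *: x i = a *: x i0 + b *: x i1.
  rewrite (bigD1 i0)//= (bigD1 i1)//= big1 ?addr0; last first.
    by move=> i /andP[/negbTE h0 /negbTE h1]; rewrite /t h0 h1 scale0r.
  by rewrite /t eqxx [i0 == i1]eq_sym (negbTE i10).
have := hMV.2 Ks t ccK t0.
rewrite (_ : mink_comb t Ks = mink2 a A b B); last first.
  apply/seteqP; split => [_ [x [xK ->]]|_ [x Ax [y By <-]]].
    rewrite tsum; exists (x i0).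
      by have := xK i0; rewrite /Ks [i0 == i1]eq_sym (negbTE i10).
    by exists (x i1) => //; have := xK i1; rewrite /Ks eqxx.
  exists (fun i => if i == i1 then y else x); split; last by rewrite tsum.
  by move=> i; rewrite /Ks; case: ifP.
move=> ->; congr (_%:E).
pose phi (S : {set 'I_n.+2}) : {ffun 'I_n.+2 -> 'I_n.+2} :=
  [ffun k => if k \in S then i1 else i0].
pose psi (f : {ffun 'I_n.+2 -> 'I_n.+2}) := finset (fun k => f k == i1).
pose P (f : {ffun 'I_n.+2 -> 'I_n.+2}) := [forall k, (f k == i1) || (f k == i0)].
(* A map taking a value outside [{i0, i1}] contributes a zero weight. *)
rewrite (bigID P)/= [X in _ + X]big1 ?addr0; last first.
  move=> f /forallPn[k]; rewrite negb_or => /andP[/negbTE h1 /negbTE h0].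
  by rewrite (bigD1 k)//= {1}/t h1 h0 !mul0r.
rewrite (reindex_onto phi psi)/=; last first.
  move=> f /forallP Pf; apply/ffunP => k; rewrite ffunE inE.
  by have /orP[/eqP->|/eqP->] := Pf k; rewrite ?eqxx// [i0 == i1]eq_sym (negbTE i10).
rewrite (eq_bigl xpredT); last first.
  move=> S; apply/andP; split.
    by apply/forallP => k; rewrite ffunE; case: ifP; rewrite eqxx ?orbT.
  apply/eqP/setP => k; rewrite inE ffunE.
  by case: ifP; rewrite ?eqxx// [i0 == i1]eq_sym.
rewrite -(sum_subsets _ (fun j => a ^+ (n.+2 - j) * b ^+ j * MVj MV j A B)).
apply: eq_bigr => S _; congr (_ * _).
  rewrite (bigID (mem S))/= mulrC; congr (_ * _).
    rewrite (eq_bigr (fun=> a)); last first.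
      by move=> k /negbTE kS; rewrite ffunE kS /t [i0 == i1]eq_sym (negbTE i10) eqxx.
    rewrite prodr_const; congr (_ ^+ _).
    have SC := cardC (mem S); rewrite card_ord in SC.
    by rewrite -[X in (X - _)%N]SC addKn; apply: eq_card => k; rewrite inE.
  rewrite (eq_bigr (fun=> b)); last by move=> k kS; rewrite ffunE kS /t eqxx.
  by rewrite prodr_const.
rewrite -MV_set//; congr MV; apply/funext => k.
by rewrite /Ks ffunE; case: (k \in S); rewrite ?eqxx// eq_sym (negbTE i10).
Qed.

End Minkowski.

(** * Convex geometry *)

Section Geometry.
Context {R : realType} {n : nat}.
Implicit Types (A B K L G : set 'rV[R]_n) (u v x y : 'rV[R]_n).

Definition dot u v : R := \sum_(i < n) u ord0 i * v ord0 i.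

Lemma dotD u v w : dot u (v + w) = dot u v + dot u w.
Proof. by rewrite -big_split; apply: eq_bigr => i _; rewrite mxE mulrDr. Qed.

Lemma dotZ u c v : dot u (c *: v) = c * dot u v.
Proof. by rewrite mulr_sumr; apply: eq_bigr => i _; rewrite mxE mulrCA. Qed.

Lemma dotB u v w : dot u (v - w) = dot u v - dot u w.
Proof. by rewrite -scaleN1r dotD dotZ mulN1r. Qed.

Lemma dot_sqrB u t v :
  dot (u - t *: v) (u - t *: v) =
  dot u u - 2 * (t * dot u v) + t * (t * dot v v).
Proof.
rewrite /dot !mulr_sumr -sumrB -big_split.
by apply: eq_bigr => i _ /=; rewrite !mxE; ring.
Qed.

Lemma dot_ge0 u : 0 <= dot u u.
Proof. by apply: sumr_ge0 => i _; rewrite -expr2 sqr_ge0. Qed.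

Lemma enorm_ge0 u : 0 <= enorm u.
Proof. exact: sqrtr_ge0. Qed.

Lemma enorm_sqr u : enorm u ^+ 2 = dot u u.
Proof.
rewrite sqr_sqrtr; last by apply: sumr_ge0 => i _; exact: sqr_ge0.
by apply: eq_bigr => i _; rewrite expr2.
Qed.

Lemma coord_le_enorm u i : `|u ord0 i| <= enorm u.
Proof.
rewrite -sqrtr_sqr ler_wsqrtr// (bigD1 i)//= lerDl.
by apply: sumr_ge0 => j _; exact: sqr_ge0.
Qed.

Lemma dot_le u v (M : R) : (forall i, `|v ord0 i| <= M) ->
  `|dot u v| <= n%:R * M * enorm u.
Proof.
move=> vM; apply: le_trans (ler_norm_sum _ _ _) _.
rewrite [leRHS](_ : _ = \sum_(i < n) (enorm u * M)).
  by apply: ler_sum => i _; rewrite normrM ler_pM// coord_le_enorm.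
by rewrite sumr_const card_ord -mulr_natl; ring.
Qed.

Lemma enorm_le v (M : R) : (forall i, `|v ord0 i| <= M) -> 0 <= M ->
  enorm v <= n%:R * M.
Proof.
move=> vM M0; have := dot_le v vM; rewrite ger0_norm ?dot_ge0// -enorm_sqr.
have := enorm_ge0 v; rewrite le_eqVlt => /orP[/eqP<-|v0].
  by rewrite mulr_ge0.
by rewrite expr2 ler_pM2r.
Qed.

Lemma cvg_sum_ord (T : Type) (F : set_system T) {FF : Filter F}
    (f : 'I_n -> T -> R) (l : 'I_n -> R) :
  (forall i, f i @ F --> l i) ->
  (fun z => \sum_(i < n) f i z) @ F --> \sum_(i < n) l i.
Proof. by move=> fl; apply: cvg_big => //; exact: add_continuous. Qed.

Lemma dot_continuous u : continuous (dot u).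
Proof.
move=> x; apply: (@cvg_sum_ord _ (nbhs x) _ (fun i y => u ord0 i * y ord0 i)).
by move=> i; apply: cvgM; [exact: cvg_cst|exact: coord_continuous].
Qed.

Lemma compact_coord_bound A : compact A ->
  exists2 M : R, 0 < M & forall x, A x -> forall i, `|x ord0 i| <= M.
Proof.
move=> /compact_bounded /ex_strict_bound_gt0[M M0 hM]; exists M => // x /hM xM i.
apply: le_trans (ltW xM); rewrite [leRHS]/Num.norm/= mx_normrE.
by apply/bigmax_geP; right; exists (ord0, i).
Qed.

Lemma interior_cube A : A° !=set0 -> exists p, exists2 r : R, 0 < r &
  forall v, (forall i, `|v ord0 i| <= r) -> A (p + v).
Proof.
move=> [p /nbhs_ballP[e /= e0 eA]]; exists p, (e / 2); first by rewrite divr_gt0.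
move=> v vr; apply: eA; split=> // i j.
rewrite (ord1 i) mxE -ball_normE /= opprD addrA subrr sub0r normrN.
apply: le_lt_trans (vr j) _; lra.
Qed.

(* The points realising a gap of [dot u] differ by a definite amount in some
   coordinate, so finitely many coordinate hyperplanes separate [A] from [B]. *)
Lemma volume_sepU A B u (M eta : R) : volume (@set0 'rV[R]_n) = 0%E ->
  (forall x i, A x -> `|x ord0 i| <= M) -> (forall x i, B x -> `|x ord0 i| <= M) ->
  0 < eta -> (forall x y, A x -> B y -> dot u x + eta <= dot u y) ->
  (volume A + volume B <= volume (A `|` B))%E.
Proof.
move=> vol0 AM BM eta0 sep.
pose U := 1 + \sum_(i < n) `|u ord0 i|.
have U0 : 0 < U by rewrite ltr_wpDr// sumr_ge0.
(* If all coordinates of [y - x] were below [2 h] in absolute value, [dot u] would grow by at most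
   [(U - 1) * (2 * h) = eta - 2 * h]. *)
pose h := eta / U / 2.
have h0 : 0 < h by rewrite !divr_gt0.
(* The largest grid index used is [(Num.truncn (2 * M / h)).+1], and [iota 0 N] stops before [N]. *)
pose N := (Num.truncn (2 * M / h)).+2.
pose cuts := [seq (i, - M + k%:R * h) | i <- enum 'I_n, k <- iota 0 N].
have cutP i a b : `|a| <= M -> `|b| <= M -> a + 2 * h <= b ->
    exists2 c, (i, c) \in cuts & a < c < b.
  move=> aM bM ab; have M0 : 0 <= M := le_trans (normr_ge0 _) aM.
  have /andP[aM1 aM2] : - M <= a <= M by rewrite -ler_norml.
  have q0 : 0 <= (a + M) / h by rewrite divr_ge0 ?(ltW h0)//; lra.
  have /andP[k1 k2] := truncn_itv q0.
  exists (- M + (Num.truncn ((a + M) / h)).+1%:R * h).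
    apply/allpairsP; exists (i, (Num.truncn ((a + M) / h)).+1).
    split; [by rewrite mem_enum| |by []].
    rewrite mem_iota add0n /N 2!ltnS /=.
    apply: le_truncn; rewrite ler_pM2r ?invr_gt0//; lra.
  have h1 : (a + M) < (Num.truncn ((a + M) / h)).+1%:R * h.
    by rewrite -ltr_pdivrMr.
  have h2 : (Num.truncn ((a + M) / h))%:R * h <= a + M.
    by rewrite -ler_pdivlMr.
  rewrite -natr1 in h1 *; apply/andP; split; lra.
apply: (@volume_superadd _ _ cuts) => // x y Ax By.
have [i] : exists i, 2 * h <= `|y ord0 i - x ord0 i|.
  apply: contrapT => /forallNP small.
  have : dot u y - dot u x < eta.
    rewrite -dotB; apply: (@le_lt_trans _ _ (\sum_(i < n) `|u ord0 i| * (2 * h))).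
      apply: ler_sum => i _; rewrite !mxE; apply: le_trans (ler_norm _) _.
      by rewrite normrM ler_wpM2l// ltW// ltNge; apply/negP.
    rewrite -mulr_suml.
    have -> : \sum_(i < n) `|u ord0 i| = U - 1 by rewrite /U; ring.
    have -> : (U - 1) * (2 * h) = eta - 2 * h.
      by rewrite /h; field; rewrite gt_eqF.
    by rewrite ltrBlDr ltrDl mulr_gt0.
  by have := sep _ _ Ax By; lra.
rewrite ler_normr => /orP[] gap.
  have [|c cin xcy] := cutP i _ _ (AM _ i Ax) (BM _ i By); first by lra.
  by apply/hasP; exists (i, c) => //=; rewrite xcy.
have [|c cin xcy] := cutP i _ _ (BM _ i By) (AM _ i Ax); first by lra.
by apply/hasP; exists (i, c) => //=; rewrite xcy orbT.
Qed.

(** [y0] minimises the distance to [x]; if some [y] violated the inequality, a step from [y0]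
    towards [y] would come nearer. *)
Lemma nearest_point K x : cc_set K ->
  exists2 y0, K y0 & forall y, K y -> dot (x - y0) (y - y0) <= 0.
Proof.
move=> [cpK [cK K0]].
have cf : {within K, continuous (fun y => dot (x - y) (x - y))}.
  apply: continuous_subspaceT => y.
  apply: (@cvg_sum_ord _ (nbhs y) _
    (fun i z => (x - z) ord0 i * (x - z) ord0 i)) => i.
  have ci : (fun z : 'rV[R]_n => (x - z) ord0 i) @ y --> (x - y) ord0 i.
    rewrite (_ : (fun _ => _) = (fun z : 'rV[R]_n => x ord0 i - z ord0 i)).
      rewrite !mxE; apply: (@cvgB R R _ (nbhs y) _ (fun=> x ord0 i)
        (fun z : 'rV[R]_n => z ord0 i)); first exact: cvg_cst.
      exact: coord_continuous.
    by apply/funext => z; rewrite !mxE.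
  exact: cvgM.
have [y0 /set_mem Ky0 y0min] := compact_EVT_min K0 cpK cf.
exists y0 => // y Ky; rewrite leNgt; apply/negP => D0.
set D := dot _ _ in D0; pose Q := dot (y - y0) (y - y0).
have Q0 : 0 <= Q := dot_ge0 _.
(* This [t] satisfies [t * Q = D - t * D], so the step changes the squared distance by
   [- t * D - t * (t * D) < 0]. *)
pose t := D / (D + Q).
have DQ0 : 0 < D + Q by lra.
have t0 : 0 < t by rewrite divr_gt0.
have t1 : t <= 1 by rewrite ler_pdivrMr// mul1r; lra.
have Kt : K (t *: y + (1 - t) *: y0) by apply: cK => //; rewrite ltW.
have := y0min _ (mem_set Kt).
have -> : x - (t *: y + (1 - t) *: y0) = (x - y0) - t *: (y - y0).
  by apply/rowP => i; rewrite !mxE; ring.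
rewrite dot_sqrB -/D -/Q.
have tQ : t * Q = D - t * D by rewrite /t; field; rewrite gt_eqF.
have : t * (t * Q) = t * D - t * (t * D) by rewrite tQ; ring.
have tD0 : 0 < t * D by rewrite mulr_gt0.
have : 0 < t * (t * D) by rewrite mulr_gt0.
by lra.
Qed.

Lemma compact_mink2 A B (a b : R) :
  compact A -> compact B -> compact (mink2 a A b B).
Proof.
move=> cA cB; pose f (z : 'rV[R]_n * 'rV[R]_n) := a *: z.1 + b *: z.2.
rewrite (_ : mink2 a A b B = f @` (A `*` B)).
  apply: continuous_compact; last exact: compact_setX.
  apply: continuous_subspaceT => z.
  apply: (@cvgD _ _ _ (nbhs z) _ (fun z => a *: z.1) (fun z => b *: z.2)).
    by apply: cvgZl_tmp; exact: cvg_fst.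
  by apply: cvgZl_tmp; exact: cvg_snd.
apply/seteqP; split => [_ [x Ax [y By <-]]|_ [[x y] [Ax By] <-]].
  by exists (x, y).
by exists x => //; exists y.
Qed.

Lemma compact_closed_rV A : compact A -> closed A.
Proof. by apply: compact_closed; exact: norm_hausdorff. Qed.

Lemma subset_cchull_l K L : K `<=` cchull_union K L.
Proof. by move=> x Kx C _ _; apply; left. Qed.

Lemma subset_cchull_r K L : L `<=` cchull_union K L.
Proof. by move=> x Lx C _ _; apply; right. Qed.

Lemma cchull_unionC K L : cchull_union K L = cchull_union L K.
Proof.
by apply/seteqP; split => x h C cC vC; rewrite setUC => /h; exact.
Qed.

Lemma cchull_sub K L C : compact C -> Defs.convex_set C -> K `<=` C -> L `<=` C ->
  cchull_union K L `<=` C.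
Proof.
move=> cC vC KC LC x; apply => //; first exact: compact_closed_rV.
by move=> z [/KC|/LC].
Qed.

Lemma cc_cchull K L G : compact G -> Defs.convex_set G -> K `<=` G -> L `<=` G ->
  K !=set0 -> cc_set (cchull_union K L).
Proof.
move=> cG vG KG LG [x Kx]; split; [|split].
- apply: (subclosed_compact _ cG); last exact: cchull_sub.
  move=> z clz C cC vC KLC; apply: (cC); apply: closure_subset clz => w hw.
  exact: (hw C cC vC KLC).
- move=> y z t hy hz t01 C cC vC KLC.
  by apply: (vC) => //; [exact: (hy C)|exact: (hz C)].
- by exists x; exact: subset_cchull_l.
Qed.

End Geometry.

(** * The integral of the slice volumes *)

Section CayleyVolume.
Context {R : realType} {n : nat} (G : set 'rV[R]_n.+1).
Variable MV : ('I_n.+1 -> set 'rV[R]_n.+1) -> R.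
Hypotheses (bodyG : convex_body G) (hMV : is_mixed_volume MV).
Implicit Types K L H : set 'rV[R]_n.+1.

(* [cayley_volume K / (n + 2)] is the volume, in dimension [n + 2], of the
   convex hull of [G * {0}] and [K * {1}], whose slice at height [t] is
   [(1 - t) G + t K]. *)
Definition cayley_volume K : R := \sum_(j < n.+2) MVj MV j G K.

(** Its values on [[0, 1]] are the volumes of [(1 - t) G + t K], expanded in the Bernstein basis. *)
Definition slice_poly K : {poly R} := \sum_(j < n.+2)
  ('C(n.+1, j)%:R * MVj MV j G K) *: ((1 - 'X) ^+ (n.+1 - j) * 'X^j).

Lemma horner_slice_poly K t : (slice_poly K).[t] = \sum_(j < n.+2)
  'C(n.+1, j)%:R * ((1 - t) ^+ (n.+1 - j) * t ^+ j * MVj MV j G K).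
Proof.
rewrite horner_sum; apply: eq_bigr => j _.
rewrite hornerZ hornerM horner_exp hornerXn hornerD hornerN hornerX.
by rewrite -polyC1 hornerC; ring.
Qed.

Lemma cc_body : cc_set G.
Proof.
have [cG [vG [p pG]]] := bodyG; split=> //; split=> //.
by exists p; exact: interior_subset.
Qed.

Lemma volume_slice K t : cc_set K -> 0 <= t <= 1 ->
  volume (mink2 (1 - t) G t K) = ((slice_poly K).[t])%:E.
Proof.
move=> ccK /andP[t0 t1]; rewrite horner_slice_poly (volume_mink2 hMV) ?subr_ge0//.
exact: cc_body.
Qed.

Lemma integral01_slice K :
  integral01 (slice_poly K) = cayley_volume K / n.+2%:R.
Proof.
rewrite integral01_sum mulr_suml; apply: eq_bigr => j _.
have jn : (j <= n.+1)%N by rewrite -ltnS.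
have := integral01_beta (n.+1 - j) j (R := R); rewrite subnK// natrM.
set J := integral01 _ => JE.
have n0 : (n.+2%:R : R) != 0 by rewrite pnatr_eq0.
apply: (mulIf n0); rewrite divfK//.
transitivity (MVj MV j G K * (J * ('C(n.+1, j)%:R * n.+2%:R))); first by ring.
by rewrite JE mulr1.
Qed.

Lemma d_GE K L : d_G MV G K L =
  (cayley_volume (cchull_union K L) - cayley_volume K) +
  (cayley_volume (cchull_union K L) - cayley_volume L).
Proof.
rewrite /d_G big_mkord /cayley_volume -!sumrB -big_split /=.
by apply: eq_bigr => j _; ring.
Qed.

Lemma le_slice K H t : cc_set K -> cc_set H -> K `<=` H -> 0 <= t <= 1 ->
  (slice_poly K).[t] <= (slice_poly H).[t].
Proof.
move=> ccK ccH KH t01; rewrite -lee_fin -!volume_slice//.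
by apply: le_volume => _ [x Gx [y /KH Hy <-]]; exists x => //; exists y.
Qed.

Lemma slice_ge0 K t : cc_set K -> 0 <= t <= 1 -> 0 <= (slice_poly K).[t].
Proof. by move=> ccK t01; rewrite -lee_fin -volume_slice// volume_ge0. Qed.

Lemma le_cayley_volume K H (c : R) : cc_set K -> cc_set H -> K `<=` H ->
  (forall t, 1/2 <= t <= 3/4 -> c <= (slice_poly H).[t] - (slice_poly K).[t]) ->
  n.+2%:R * (c / 4) <= cayley_volume H - cayley_volume K.
Proof.
move=> ccK ccH KH gap.
have := @integral01_ge R (slice_poly H - slice_poly K) c.
rewrite integral01B !integral01_slice => ge.
have n0 : 0 < (n.+2%:R : R) by rewrite ltr0n.
rewrite mulrC -ler_pdivlMr// mulrBl; apply: ge => t t01.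
  by rewrite hornerD hornerN subr_ge0 le_slice.
by rewrite hornerD hornerN gap.
Qed.

Lemma cayley_volume_mono K H : cc_set K -> cc_set H -> K `<=` H ->
  cayley_volume K <= cayley_volume H.
Proof.
move=> ccK ccH KH; rewrite -subr_ge0.
apply: le_trans (le_cayley_volume (c := 0) ccK ccH KH _).
  by rewrite mul0r mulr0.
move=> t t01; rewrite subr_ge0 le_slice//.
by move: t01 => /andP[? ?]; apply/andP; split; lra.
Qed.

Lemma cayley_volume_ge0 K : cc_set K -> 0 <= cayley_volume K.
Proof.
move=> ccK; have := @integral01_ge R (slice_poly K) 0.
rewrite integral01_slice mul0r => ge.
rewrite -(@pmulr_lge0 _ (n.+2%:R)^-1) ?invr_gt0 ?ltr0n//; apply: ge => t t01.
  exact: slice_ge0.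
by apply: slice_ge0 => //; move: t01 => /andP[? ?]; apply/andP; split; lra.
Qed.

(** Homogeneity, with [s G] written with a second body of weight 0: only the term [j = 0] survives,
    since [0 ^+ 0 = 1]. *)
Lemma volume_scale K s : cc_set K -> 0 <= s ->
  volume (mink2 s G 0 K) = (s ^+ n.+1 * MV (fun=> G))%:E.
Proof.
move=> ccK s0; rewrite (volume_mink2 hMV cc_body ccK s0 (lexx 0)); congr (_%:E).
rewrite big_ord_recl big1 ?addr0; last first.
  by move=> j _; rewrite expr0n /= mulr0 mul0r mulr0.
rewrite bin0 subn0 expr0 mul1r mulr1; congr (_ * _).
by rewrite /MVj; congr MV; apply/funext => k; rewrite subn0 ltn_ord.
Qed.

Lemma volume_body : volume G = (MV (fun=> G))%:E.
Proof.
rewrite -[MV _]mul1r -(expr1n R n.+1) -(volume_scale cc_body ler01).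
congr volume; apply/seteqP; split => [x Gx|_ [x Gx [y _ <-]]].
  by exists x => //; exists x => //; rewrite scale1r scale0r addr0.
by rewrite scale1r scale0r addr0.
Qed.

Lemma volume_body_gt0 : 0 < MV (fun=> G).
Proof.
have [_ [_ /interior_cube[p [r r0 cube]]]] := bodyG.
rewrite -lte_fin -volume_body.
have ab i : (p - const_mx r) ord0 i <= (p + const_mx r) ord0 i.
  by rewrite !mxE; lra.
apply: (@lt_le_trans _ _ (volume (box (p - const_mx r) (p + const_mx r)))).
  rewrite volume_boxE// lte_fin; apply: prodr_gt0 => i _.
  by rewrite !mxE; lra.
apply: le_volume => x xb; rewrite -[x](subrK p) addrC; apply: cube => i.
have := xb i; rewrite !mxE => /andP[? ?].
by rewrite ler_norml; apply/andP; split; lra.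
Qed.

Section Bounded.
Variable M : R.
Hypotheses (M0 : 0 < M) (GM : forall x, G x -> forall i, `|x ord0 i| <= M).

Let D : R := n.+1%:R * (2 * M).

Lemma diam_gt0 : 0 < D.
Proof. by rewrite !mulr_gt0// ltr0n. Qed.

Lemma diff_coord x y i : G x -> G y -> `|(x - y) ord0 i| <= 2 * M.
Proof.
move=> Gx Gy; rewrite !mxE; apply: le_trans (ler_normB _ _) _.
by have := GM Gx i; have := GM Gy i; lra.
Qed.

Lemma enorm_diff x y : G x -> G y -> enorm (x - y) <= D.
Proof.
move=> Gx Gy; apply: enorm_le; last by rewrite mulr_ge0// ltW.
by move=> i; exact: diff_coord.
Qed.

(* The slice of [H] contains, next to the slice of [K], a homothetic copy of
   [G] with ratio [(1 - t) * delta / (2 * D)], attached to the point of the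
   slice of [H] that is extreme in the direction [x - y0], where [y0] is the
   point of [K] nearest to [x]. *)
Lemma slice_gap K H x (delta t : R) : cc_set K -> cc_set H -> K `<=` H ->
  H `<=` G -> H x -> 0 < delta -> (forall y, K y -> delta < enorm (x - y)) ->
  1/2 <= t <= 3/4 ->
  (slice_poly K).[t] + ((1 - t) * (delta / (2 * D))) ^+ n.+1 * MV (fun=> G) <=
  (slice_poly H).[t].
Proof.
move=> ccK ccH KH HG Hx delta0 far /andP[t12 t34].
have [cG [vG G0]] := cc_body.
have D0 := diam_gt0.
have t01 : 0 <= t <= 1 by apply/andP; split; lra.
set lam := delta / (2 * D); pose s := (1 - t) * lam.
have lam0 : 0 < lam by rewrite divr_gt0// mulr_gt0.
have s0 : 0 <= s by rewrite mulr_ge0 ?(ltW lam0)//; lra.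
have [y0 Ky0 near0] := nearest_point x ccK.
pose u := x - y0; pose e := enorm u.
have e_gt : delta < e := far _ Ky0.
have eD : e <= D by apply: enorm_diff; [exact: HG|exact/HG/KH].
have lam1 : lam <= 1 by rewrite /lam ler_pdivrMr ?mulr_gt0//; lra.
have cu : {within G, continuous (dot u)}.
  by apply: continuous_subspaceT; exact: dot_continuous.
have [g /set_mem Gg gmax] := compact_EVT_max G0 cG cu.
(* The set [B] below is [(1 - t) (lam G + (1 - lam) g) + t x], which convexity of [G] places in the
   slice of [H]. *)
pose v := ((1 - t) * (1 - lam)) *: g + t *: x.
pose A := mink2 (1 - t) G t K.
pose B := [set w + v | w in mink2 s G 0 G].
have BH : B `<=` mink2 (1 - t) G t H.
  move=> _ [_ [g1 Gg1 [g2 _ <-]] <-].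
  exists (lam *: g1 + (1 - lam) *: g); first by apply: vG => //; rewrite ltW.
  exists x => //; rewrite /v /s scale0r addr0 scalerDr !scalerA.
  by rewrite addrA.
have AH : A `<=` mink2 (1 - t) G t H.
  by move=> _ [g1 Gg1 [y /KH Hy <-]]; exists g1 => //; exists y.
have HM z i : mink2 (1 - t) G t H z -> `|z ord0 i| <= M.
  move=> [g1 Gg1 [y Hy <-]]; have /GM/(_ i) : G (t *: y + (1 - t) *: g1).
    by apply: vG => //; exact: HG.
  by rewrite addrC.
(* Passing from [K] to [x] gains at least [t * e ^+ 2 >= e * delta / 2], as [t >= 1/2]; the width of
   the copy of [G] costs at most [s * (D * e) <= e * delta / 4]. *)
have gap a b : A a -> B b -> dot u a + e * delta / 4 <= dot u b.
  move=> [g1 Gg1 [y Ky <-]] [_ [g2 Gg2 [g3 _ <-]] <-].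
  rewrite /v scale0r addr0 !dotD !dotZ.
  have h1 : dot u g1 <= dot u g by apply: gmax; rewrite inE.
  have h2 : - (D * e) <= dot u g2 - dot u g.
    rewrite -dotB lerNl; apply: le_trans (ler_norm _) _; rewrite normrN.
    by apply: dot_le => i; exact: diff_coord.
  have h3 : dot u x - dot u y = e ^+ 2 - dot u (y - y0).
    rewrite enorm_sqr -!dotB; congr (dot u _ : R).
    by apply/rowP => i; rewrite !mxE; ring.
  have h4 : dot u (y - y0) <= 0 := near0 _ Ky.
  have h5 : s * (D * e) = (1 - t) * (e * delta / 2).
    by rewrite /s /lam; field; rewrite gt_eqF.
  have h6 : s * - (D * e) <= s * (dot u g2 - dot u g) by rewrite ler_wpM2l.
  have h7 : (1 - t) * dot u g1 <= (1 - t) * dot u g by rewrite ler_wpM2l//; lra.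
  have h8 : t * (e ^+ 2) <= t * (dot u x - dot u y) by rewrite ler_wpM2l//; lra.
  have h9 : e * delta <= e ^+ 2 by rewrite expr2 ler_wpM2l ?enorm_ge0// ltW.
  have ed0 : 0 <= e * delta by rewrite mulr_ge0 ?enorm_ge0// ltW.
  have h10 : 1/2 * (e * delta) <= t * e ^+ 2 by apply: ler_pM => //; lra.
  have h11 : (1 - t) * (e * delta / 2) <= 1/2 * (e * delta / 2).
    by apply: ler_wpM2r; lra.
  have -> : (1 - t) * (1 - lam) * dot u g = (1 - t) * dot u g - s * dot u g.
    by rewrite /s; ring.
  move: h6 h8; rewrite mulrN h5 !mulrBr => h6 h8.
  lra.
have eta0 : 0 < e * delta / 4.
  by rewrite divr_gt0// mulr_gt0// (lt_trans delta0).
rewrite -lee_fin EFinD -!volume_slice//.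
rewrite -(volume_scale cc_body s0) -[volume (mink2 s _ _ _)](volume_translate _ v).
apply: le_trans (_ : (volume (A `|` B) <= _)%E); last first.
  by apply: le_volume => z [/AH|/BH].
apply: (@volume_sepU _ _ _ _ u M (e * delta / 4)) => //.
- exact: volume0.
- by move=> z i /AH; exact: HM.
- by move=> z i /BH; exact: HM.
Qed.

(** The slice gap is integrated: for [t <= 3/4] the ratio of the copy is at least [1/4 * (delta / (2
    * D)) = delta / (8 * D)]. *)
Lemma cayley_gap K H x (delta : R) : cc_set K -> cc_set H -> K `<=` H ->
  H `<=` G -> H x -> 0 < delta -> (forall y, K y -> delta < enorm (x - y)) ->
  n.+2%:R * ((delta / (8 * D)) ^+ n.+1 * MV (fun=> G) / 4) <=
  cayley_volume H - cayley_volume K.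
Proof.
move=> ccK ccH KH HG Hx delta0 far; apply: le_cayley_volume => // t t01.
rewrite lerBrDl; apply: le_trans (slice_gap ccK ccH KH HG Hx delta0 far t01).
rewrite lerD2l ler_wpM2r ?(ltW volume_body_gt0)//.
have D0 := diam_gt0; have dD : 0 < delta / D by rewrite divr_gt0.
have -> : delta / (8 * D) = 1/4 * (delta / D / 2) by field; rewrite gt_eqF.
have -> : delta / (2 * D) = delta / D / 2 by field; rewrite gt_eqF.
move: t01 => /andP[? ?].
apply: lerXn2r; rewrite ?nnegrE.
- by rewrite mulr_ge0//; lra.
- by rewrite mulr_ge0//; lra.
- by apply: ler_wpM2r; lra.
Qed.

End Bounded.

(** [Vol (G + t K)] is a polynomial in [t] whose coefficients are the [MV_j (G, K)] times binomials.
    At [t = 0, ..., n.+1] it is at most [Vol (G + t G)], so [coef_bound] applies. *)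
Lemma MVj_bounded : exists2 C : R, 0 <= C & forall K, cc_set K -> K `<=` G ->
  forall j : 'I_n.+2, `|MVj MV j G K| <= C.
Proof.
have [C C0 hC] := @coef_bound R n.+1.
pose W K (t : R) : R := \sum_(j < n.+2)
  'C(n.+1, j)%:R * (1 ^+ (n.+1 - j) * t ^+ j * MVj MV j G K).
have WE K t : cc_set K -> 0 <= t -> volume (mink2 1 G t K) = (W K t)%:E.
  by move=> ccK t0; rewrite (volume_mink2 hMV cc_body ccK ler01 t0).
pose S := \sum_(t < n.+2) `|W G t%:R|.
have S0 : 0 <= S by apply: sumr_ge0.
exists (C * S); first by rewrite mulr_ge0.
move=> K ccK KG j.
have := hC (fun j => 'C(n.+1, j)%:R * MVj MV j G K) S S0 _ j.
have bin1 : 1 <= ('C(n.+1, j)%:R : R) by rewrite ler1n bin_gt0 -ltnS.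
move=> bnd; apply: le_trans (bnd _).
  by rewrite normrM ler_peMl// ger0_norm// (le_trans ler01).
move=> t; rewrite (_ : \sum_(i < n.+2) _ = W K t%:R); last first.
  by apply: eq_bigr => i _; rewrite expr1n; ring.
have t0 : 0 <= t%:R :> R by [].
have WK0 : 0 <= W K t%:R by rewrite -lee_fin -WE// volume_ge0.
rewrite ger0_norm//; apply: (@le_trans _ _ (W G t%:R)).
  rewrite -lee_fin -!WE//; last exact: cc_body.
  by apply: le_volume => _ [x Gx [y /KG Gy <-]]; exists x => //; exists y.
apply: le_trans (ler_norm _) _.
by rewrite /S (bigD1 t)//= lerDl sumr_ge0.
Qed.

(* [H `<=` K + s (G - p)] gives [(1 - t) G + t H `<=` (1 - t + t s) G + t K]
   up to a translation. *)
Lemma slice_le_translate K H p s t : cc_set K -> cc_set H -> 0 <= s ->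
  0 <= t <= 1 ->
  (forall x, H x -> exists2 y, K y & exists2 g, G g & x = y + s *: (g - p)) ->
  (slice_poly H).[t] <= \sum_(j < n.+2) 'C(n.+1, j)%:R *
    ((1 - t + t * s) ^+ (n.+1 - j) * t ^+ j * MVj MV j G K).
Proof.
move=> ccK ccH s0 /andP[t0 t1] HK.
have [_ [vG _]] := cc_body.
have a0 : 0 <= 1 - t + t * s by rewrite addr_ge0 ?mulr_ge0 ?subr_ge0.
rewrite -lee_fin -volume_slice ?t0// -(volume_mink2 hMV cc_body ccK a0 t0).
rewrite -[leRHS](volume_translate _ (- (t * s) *: p)).
apply: le_volume => _ [g Gg [_ /HK[y Ky [g' Gg' ->]] <-]].
(* The weight vanishes only if [t = 1] and [s = 0]; otherwise one may divide by it. *)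
have [a1|a1] := eqVneq (1 - t + t * s) 0.
  exists (0 *: g + t *: y); first by rewrite -a1; exists g => //; exists y.
  have ts0 : 0 <= t * s by rewrite mulr_ge0.
  have ts : t * s = 0 by lra.
  have t11 : t = 1 by lra.
  have s00 : s = 0 by rewrite -[s]mul1r -t11.
  by apply/rowP => i; rewrite !mxE s00 t11; ring.
(* [q] makes [(1 - t) g + t s g'] the weight times the point [q g + (1 - q) g'] of [G]. *)
pose q := (1 - t) / (1 - t + t * s).
have q1 : 1 - q = t * s / (1 - t + t * s) by rewrite /q; field.
have q01 : 0 <= q <= 1.
  by rewrite divr_ge0 ?subr_ge0//= -subr_ge0 q1 divr_ge0// mulr_ge0.
exists ((1 - t + t * s) *: (q *: g + (1 - q) *: g') + t *: y).
  by exists (q *: g + (1 - q) *: g'); [exact: vG|exists y].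
by apply/rowP => i; rewrite !mxE q1 /q; field.
Qed.

(** For [s <= 1], the bound of [slice_le_translate] and the slice polynomial of [K] are compared
    term by term, by [expr_lip] and [MVj_bounded], and the result is integrated. For [s > 1] the
    trivial bound [cayley_volume G] suffices. *)
Lemma cayley_volume_lip : exists2 C : R, 0 <= C & forall K H p s,
  cc_set K -> cc_set H -> K `<=` G -> H `<=` G -> 0 <= s ->
  (forall x, H x -> exists2 y, K y & exists2 g, G g & x = y + s *: (g - p)) ->
  cayley_volume H - cayley_volume K <= C * s.
Proof.
have [C C0 MVC] := MVj_bounded.
pose C1 : R := \sum_(j < n.+2) 'C(n.+1, j)%:R * (n.+1%:R * 2 ^+ n.+1 * C).
have C10 : 0 <= C1.
  by apply: sumr_ge0 => j _; rewrite !mulr_ge0.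
(* One summand for each case; [n.+2] undoes the division in [integral01_slice]. *)
exists (n.+2%:R * C1 + cayley_volume G).
  by rewrite addr_ge0 ?mulr_ge0// cayley_volume_ge0//; exact: cc_body.
move=> K H p s ccK ccH KG HG s0 HK.
have FG0 := cayley_volume_ge0 cc_body.
have [s1|s1] := leP s 1; last first.
  have := cayley_volume_mono ccH cc_body HG; have := cayley_volume_ge0 ccK.
  have : cayley_volume G <= cayley_volume G * s by rewrite ler_peMr// ltW.
  have : 0 <= n.+2%:R * C1 * s by rewrite !mulr_ge0.
  by rewrite mulrDl; lra.
have step t : 0 <= t <= 1 -> (slice_poly H).[t] - (slice_poly K).[t] <= C1 * s.
  move=> t01; have /andP[t0 t1] := t01.
  have := slice_le_translate ccK ccH s0 t01 HK.
  rewrite -(lerD2r (- (slice_poly K).[t])) => /le_trans; apply.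
  rewrite [in leLHS]horner_slice_poly -sumrB mulr_suml; apply: ler_sum => j _.
  rewrite -mulrBr -[leRHS]mulrA ler_wpM2l//.
  set k := (n.+1 - j)%N.
  have kn : (k <= n.+1)%N by exact: leq_subr.
  have ts0 : 0 <= t * s by rewrite mulr_ge0.
  have ts1 : t * s <= s by rewrite ler_piMl.
  have ts2 : t * s <= t by rewrite ler_piMr.
  have pw : (1 - t + t * s) ^+ k - (1 - t) ^+ k <= s * (n.+1%:R * 2 ^+ n.+1).
    apply: le_trans (expr_lip _ _ _ _) _; [lra..|].
    rewrite addrAC subrr add0r; apply: ler_pM => //.
    apply: ler_pM => //.
      by rewrite ler_nat.
    by apply: ler_weXn2l => //; rewrite ler1n.
  have pw0 : 0 <= (1 - t + t * s) ^+ k - (1 - t) ^+ k.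
    by rewrite subr_ge0; apply: lerXn2r; rewrite ?nnegrE; lra.
  have tj0 : 0 <= t ^+ j by rewrite exprn_ge0.
  have tj1 : t ^+ j <= 1 by rewrite exprn_ile1.
  rewrite -!mulrBl; apply: le_trans (ler_norm _) _.
  rewrite normrM normrM (ger0_norm pw0) (ger0_norm tj0).
  rewrite [leRHS](_ : _ = (s * (n.+1%:R * 2 ^+ n.+1)) * 1 * C); last by ring.
  apply: ler_pM => //; first by rewrite mulr_ge0.
    by apply: ler_pM.
  exact: MVC.
have := @integral01_ge R ((C1 * s)%:P - (slice_poly H - slice_poly K)) 0.
have intC : integral01 (C1 * s)%:P = C1 * s :> R.
  rewrite (@integral01E _ _ ((C1 * s) *: 'X)).
    by rewrite !hornerZ !hornerX; ring.
  by rewrite derivZ derivX alg_polyC.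
rewrite mul0r !integral01B !integral01_slice intC => pos.
have {}pos : 0 <= C1 * s - (cayley_volume H / n.+2%:R - cayley_volume K / n.+2%:R).
  by apply: pos => t t01; rewrite !(hornerD, hornerN, hornerC) subr_ge0;
    apply: step; move: t01 => /andP[? ?]; apply/andP; split; lra.
have n0 : 0 < (n.+2%:R : R) by rewrite ltr0n.
move: pos; rewrite subr_ge0 -mulrBl ler_pdivrMr// => pos.
apply: (le_trans pos); rewrite mulrDl [C1 * s * _]mulrC mulrA lerDl.
by rewrite mulr_ge0.
Qed.

End CayleyVolume.

(** * The Hausdorff distance *)

(** Here each box has volume the empty product 1, so every cover has infinite total volume. *)
Lemma volume_dim0 (R : realType) (A : set 'rV[R]_0) : volume A = +oo%E.
Proof.
apply/eqP; rewrite eq_le leey; apply: le_ereal_inf_tmp => _ [a [b [_ _ ->]]].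
rewrite leye_eq; apply/eqP/eq_infty => r.
have vol1 k : (box_vol (a k) (b k))%:E = 1%E by rewrite /box_vol big_ord0.
apply: le_trans (nneseries_lim_ge (Num.truncn `|r|).+1 _); last first.
  by move=> k _ _; rewrite vol1.
under eq_bigr do rewrite vol1.
rewrite big_mkord sumEFin sumr_const card_ord lee_fin.
by apply: le_trans (ler_norm r) (ltW _); exact: truncnS_gt.
Qed.

Section Hausdorff.
Context {R : realType} {n : nat}.
Implicit Types K L : set 'rV[R]_n.

Let deltas K L : set R :=
  [set delta : R | 0 < delta /\ K `<=` enlarge L delta /\ L `<=` enlarge K delta].

Lemma hausdorff_dist_ge0 K L : 0 <= hausdorff_dist K L.
Proof.
have [S0|/nonemptyPn S0] := pselect (deltas K L !=set0).
  by apply: lb_le_inf => // d [/ltW].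
by rewrite /hausdorff_dist -/(deltas K L) S0 inf0.
Qed.

(** If both alternatives failed, [delta] would be admissible in the infimum. *)
Lemma hausdorff_dist_far K L (delta : R) : 0 < delta < hausdorff_dist K L ->
  (exists2 x, L x & forall y, K y -> delta < enorm (x - y)) \/
  (exists2 x, K x & forall y, L y -> delta < enorm (x - y)).
Proof.
move=> /andP[d0 dlt]; apply: contrapT => /not_orP[n1 n2].
have sub A B : ~ (exists2 x, A x & forall y, B y -> delta < enorm (x - y)) ->
    A `<=` enlarge B delta.
  move=> nAB x Ax; apply: contrapT => nx; apply: nAB; exists x => // y By.
  by rewrite ltNge; apply/negP => xy; apply: nx; exists y.
have : hausdorff_dist K L <= delta.
  apply: ge_inf; first by exists 0 => d [/ltW].
  by split=> //; split; exact: sub.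
by rewrite leNgt dlt.
Qed.

Lemma hausdorff_dist_ge K L (D c : R) :
  (forall x y, K x -> L y -> enorm (x - y) <= D) -> K !=set0 -> L !=set0 ->
  (forall delta, 0 < delta -> K `<=` enlarge L delta -> L `<=` enlarge K delta ->
     c <= delta) ->
  c <= hausdorff_dist K L.
Proof.
move=> KLD [x0 Kx0] [y0 Ly0] hc; apply: lb_le_inf; last first.
  by move=> d [d0 [KL LK]]; exact: hc.
have enormN u : enorm (- u) = enorm u :> R.
  by rewrite /enorm; congr Num.sqrt; apply: eq_bigr => i _; rewrite mxE sqrrN.
have D0 : 0 <= D := le_trans (enorm_ge0 _) (KLD _ _ Kx0 Ly0).
(* [D + 1] is admissible, so the infimum is not the default value 0 of an empty set. *)
exists (D + 1); split; first by lra.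
split=> z hz; [exists y0 => //|exists x0 => //].
  by apply: le_trans (KLD _ _ hz Ly0) _; lra.
by rewrite -opprB enormN; apply: le_trans (KLD _ _ Kx0 hz) _; lra.
Qed.

End Hausdorff.

(** The vector [x - y], rescaled by [r / delta], fits into the cube around [p] inside [G]. *)
Lemma enlarge_translate (R : realType) n (G A : set 'rV[R]_n) (p : 'rV[R]_n)
    (r delta : R) :
  0 < r -> (forall v : 'rV[R]_n, (forall i, `|v ord0 i| <= r) -> G (p + v)) ->
  0 < delta ->
  forall x, enlarge A delta x ->
  exists2 y, A y & exists2 g, G g & x = y + (delta / r) *: (g - p).
Proof.
move=> r0 cube d0 x [y Ay xy]; exists y => //.
exists (p + (r / delta) *: (x - y)).
  apply: cube => i; rewrite mxE normrM gtr0_norm ?divr_gt0//.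
  rewrite mulrAC ler_pdivrMr// ler_wpM2l ?(ltW r0)//.
  by apply: le_trans xy; exact: coord_le_enorm.
rewrite [p + _]addrC addrK scalerA.
have -> : delta / r * (r / delta) = 1 by field; rewrite !gt_eqF.
by rewrite scale1r subrKC.
Qed.

(** [K + s (G - p)] is compact and convex; it contains [L] by hypothesis and [K] because [p] lies in
    [G], hence it contains the hull. *)
Lemma cchull_translate (R : realType) n (G K L : set 'rV[R]_n)
    (p : 'rV[R]_n) (s : R) :
  cc_set K -> compact G -> Defs.convex_set G -> G p ->
  (forall x, L x -> exists2 y, K y & exists2 g, G g & x = y + s *: (g - p)) ->
  forall x, cchull_union K L x ->
  exists2 y, K y & exists2 g, G g & x = y + s *: (g - p).
Proof.
move=> [cK [vK _]] cG vG Gp LT x.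
pose G' := mink2 1 G 1 [set - p].
have TE z : mink2 1 K s G' z <->
    exists2 y, K y & exists2 g, G g & z = y + s *: (g - p).
  split=> [[y Ky [_ [g Gg [_ -> <-]] <-]]|[y Ky [g Gg ->]]].
    by exists y => //; exists g => //; rewrite !scale1r.
  exists y => //; exists (g - p); last by rewrite scale1r.
  by exists g => //; exists (- p) => //; rewrite !scale1r.
move=> Hx; apply/TE; move: x Hx; apply: cchull_sub.
- by apply: compact_mink2 => //; apply: compact_mink2 => //; exact: compact_set1.
- apply: convex_mink2 => //; apply: convex_mink2 => // _ _ t -> -> _ /=.
  by rewrite -scalerDl addrC subrK scale1r.
- by move=> y Ky; apply/TE; exists y => //; exists p; rewrite // subrr scaler0 addr0.
- by move=> y /LT Ty; apply/TE.
Qed.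

(** * The two-sided estimate *)

Theorem theorem1p1 (R : realType) (n : nat) (G : set 'rV[R]_n)
    (MV : ('I_n -> set 'rV[R]_n) -> R) :
  convex_body G -> is_mixed_volume MV ->
  exists C : R, 1 < C /\
    forall K L : set 'rV[R]_n,
      cc_set K -> K `<=` G -> cc_set L -> L `<=` G ->
      C^-1 * hausdorff_dist K L ^+ n <= d_G MV G K L /\
      d_G MV G K L <= C * hausdorff_dist K L.
Proof.
case: n G MV => [|n] G MV bodyG hMV.
  (* In dimension 0 the volume is infinite while [is_mixed_volume] asserts a finite value: the case
     is contradictory. *)
  have I0 (P : 'I_0 -> Prop) i : P i by case: i.
  by have := hMV.2 (fun=> set0) (fun=> 0) (I0 _) (I0 _); rewrite volume_dim0.
have [cG [vG _]] := bodyG.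
have [M M0 GM] := compact_coord_bound cG.
have [_ [_ /interior_cube[p [r r0 cube]]]] := bodyG.
have Gp : G p by rewrite -[p]addr0; apply: cube => i; rewrite mxE normr0 ltW.
pose D : R := n.+1%:R * (2 * M).
have D0 : 0 < D := diam_gt0 M0.
have [C C0 lip] := cayley_volume_lip bodyG hMV.
(* The constant of [cayley_gap] at half the Hausdorff distance, with the power of the distance
   factored out. *)
pose c : R := n.+2%:R * ((1 / (16 * D)) ^+ n.+1 * MV (fun=> G) / 4).
have c0 : 0 < c.
  by rewrite mulr_gt0// divr_gt0// mulr_gt0 ?exprn_gt0 ?divr_gt0 ?mulr_gt0//
    (volume_body_gt0 bodyG hMV).
(* The summands provide for [1 < C'], [C'^-1 <= c] and [2 * C / r <= C']. *)
pose C' : R := 1 + c^-1 + 2 * C / r.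
have ci0 : 0 < c^-1 by rewrite invr_gt0.
have Cr0 : 0 <= 2 * C / r by rewrite divr_ge0 ?mulr_ge0// ltW.
exists C'; split; first by rewrite /C'; lra.
have C'0 : 0 < C' by rewrite /C'; lra.
move=> K L ccK KG ccL LG.
pose H := cchull_union K L.
have ccH : cc_set H by apply: cc_cchull cG vG KG LG _; exact: ccK.2.2.
have HG : H `<=` G by exact: cchull_sub.
have KH : K `<=` H by exact: subset_cchull_l.
have LH : L `<=` H by exact: subset_cchull_r.
have KH0 := cayley_volume_mono bodyG hMV ccK ccH KH.
have LH0 := cayley_volume_mono bodyG hMV ccL ccH LH.
have h0 := hausdorff_dist_ge0 K L.
rewrite d_GE -/H; split.
  have [->|hn0] := eqVneq (hausdorff_dist K L) 0.
    by rewrite expr0n /= mulr0; lra.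
  have hp : 0 < hausdorff_dist K L by rewrite lt_neqAle eq_sym hn0.
  set d := hausdorff_dist K L in h0 hp hn0 *.
  have cd : C'^-1 * d ^+ n.+1 <= c * d ^+ n.+1.
    rewrite ler_wpM2r ?exprn_ge0//.
    rewrite -[leRHS]invrK lef_pV2 ?posrE// /C'; lra.
  apply: (le_trans cd).
  have -> : c * d ^+ n.+1 =
      n.+2%:R * ((d / 2 / (8 * D)) ^+ n.+1 * MV (fun=> G) / 4).
    have -> : d / 2 / (8 * D) = 1 / (16 * D) * d by field; rewrite gt_eqF.
    by rewrite exprMn /c; ring.
  (* [d / 2] lies strictly below the distance, so a far point exists in [L] or in [K]. One of the
     two increments of [cayley_volume] then has the gap, and the other is nonnegative. *)
  have d2 : 0 < d / 2 by lra.
  have : 0 < d / 2 < hausdorff_dist K L by rewrite d2/= -/d; lra.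
  case/hausdorff_dist_far => -[x Ax far].
    have := cayley_gap bodyG hMV M0 GM ccK ccH KH HG (LH _ Ax) d2 far.
    by rewrite -/D; lra.
  have := cayley_gap bodyG hMV M0 GM ccL ccH LH HG (KH _ Ax) d2 far.
  by rewrite -/D; lra.
(* The upper bound is proved with each admissible [delta] in place of the infimum. *)
rewrite mulrC -ler_pdivrMr//.
apply: (hausdorff_dist_ge (D := D)).
- by move=> x y Kx Ly; apply: (enorm_diff M0 GM); [exact: KG|exact: LG].
- exact: ccK.2.2.
- exact: ccL.2.2.
move=> delta d0 KL LK; rewrite ler_pdivrMr//.
have dr0 : 0 <= delta / r by rewrite divr_ge0// ltW.
(* Used for [A = K] and [A = L]; the two increments add up to at most [2 * C * (delta / r)]. *)
have step A B : cc_set A -> A `<=` G -> B `<=` enlarge A delta ->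
    cchull_union A B = H ->
    cayley_volume G MV H - cayley_volume G MV A <= C * (delta / r).
  move=> ccA AG BA AB; apply: (lip _ _ p) => // x Hx.
  apply: (@cchull_translate _ _ G A B) => //; last by rewrite AB.
  by move=> z /BA; exact: enlarge_translate.
have := step K L ccK KG LK erefl.
have := step L K ccL LG KL (cchull_unionC _ _).
have dC : 2 * C / r * delta <= delta * C'.
  rewrite [leRHS]mulrC; apply: ler_wpM2r; first exact: ltW.
  by rewrite /C'; lra.
have -> : C * (delta / r) = 2 * C / r * delta / 2 by field; rewrite gt_eqF.
by lra.
Qed.
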